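(* Let $F=(f,g):\mathbb{R}^2\to\mathbb{R}^2$ and $\rho>0$ be as in the standing setting of the context, let $\Phi^t$ denote the flow of the four-dimensional system $(\ast)$ defined there, and assume $I(\gamma^s)\subset D_\rho$. Then there exists a set $U\subset\mathbb{R}^4$ such that (i) $\lim_{t\to\infty}\Phi^t(z_0,q_0)=0$ for every $(z_0,q_0)\in U$, and (ii) $\pi_1(U)\cap\gamma^s\neq\emptyset$, where $\pi_1(z,q)=z$.
   Context: Standing setting. $F=(f,g):\mathbb{R}^2\to\mathbb{R}^2$ is smooth. The planar system $\dot z=F(z)$, $z=(x,y)$, has only two attractors: the stable fixed point $0$ and a stable limit cycle $\gamma^s$ with $0\in I(\gamma^s)$, where $I(\gamma)$ denotes the set of points inside the closed curve $\gamma$. Their basins satisfy $\mathrm{cl}(B(\gamma^s)\cup B(0))=\mathbb{R}^2$, where $B(\cdot)$ denotes the basin of attraction and $\mathrm{cl}$ the closure. There is a unique unstable limit cycle $\gamma^u$ between $0$ and $\gamma^s$. For a constant $\rho>0$, system $(\ast)$ on $\mathbb{R}^4$ is $$\dot z=F(z)+\tilde q,\qquad \dot q=-[\rho I+D_F(z)^T]q,\qquad q=(q_1,q_2),\ \tilde q=(q_1,0),$$ where $D_F(z)$ is the Jacobian matrix of $F$ at $z$ and $I$ is the identity matrix. That is, $\dot x=f(x,y)+q_1$, $\dot y=g(x,y)$, $\dot q_1=-(\rho+f_x)q_1-g_xq_2$, $\dot q_2=-f_yq_1-(\rho+g_y)q_2$. It is assumed that the solution $\Phi^t(z,q)$ of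 $(\ast)$ starting at $(z,q)$ exists for all $(z,q)\in\mathbb{R}^4$ and all $t\in\mathbb{R}$. A (not necessarily symmetric) real matrix $A$ is called positive (negative) definite if $(A+A^T)/2$ is positive (negative) definite. The set $D_\rho$ is $D_\rho:=\{z\in\mathbb{R}^2 : -[\rho I+D_F(z)]\text{ is negative definite}\}$. *)

(* Defs.v *)
From HB Require Import structures.
From mathcomp Require Import all_boot all_order all_algebra.
From mathcomp Require Import all_classical all_reals all_analysis.
Set Implicit Arguments.
Unset Strict Implicit.
Unset Printing Implicit Defensive.
Import Order.TTheory GRing.Theory Num.Theory.
Import numFieldNormedType.Exports.
Local Open Scope classical_set_scope.
Local Open Scope ring_scope.

Section Dynamics.
Context {R : realType} {V : normedModType R}.
Implicit Types (G : V -> V) (u : R -> V) (A : set V).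

(* Solutions are defined on all of R; in the setting of this file every
   solution of the systems considered extends to the whole line. *)
Definition solution G u : Prop := forall t : R, is_derive t 1 u (G (u t)).

Definition is_flow G (Phi : R -> V -> V) : Prop :=
  forall w : V, Phi 0 w = w /\ solution G (Phi ^~ w).

Definition tends_to_set u A : Prop :=
  forall e : R, 0 < e ->
    \forall t \near +oo, exists2 a, A a & `|u t - a| < e.

Definition basin G A : set V :=
  [set w | exists u, [/\ solution G u, u 0 = w & tends_to_set u A]].

Definition invariant_set G A : Prop :=
  forall u, solution G u -> A (u 0) -> forall t, A (u t).

Definition lyapunov_stable G A : Prop :=
  forall O : set V, open O -> A `<=` O ->
    exists O' : set V, [/\ open O', A `<=` O' &
      forall u, solution G u -> O' (u 0) -> forall t, 0 <= t -> O (u t)].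

Definition attracts_nbhd G A : Prop :=
  exists O : set V, [/\ open O, A `<=` O & O `<=` basin G A].

Definition asymptotically_stable G A : Prop :=
  lyapunov_stable G A /\ attracts_nbhd G A.

(* The dense forward orbit makes attractors indecomposable: the union of two
   disjoint asymptotically stable sets, or the region bounded by a stable
   cycle, is asymptotically stable but not an attractor. *)
Definition attractor G A : Prop :=
  [/\ A !=set0, compact A, invariant_set G A, asymptotically_stable G A &
      exists u, [/\ solution G u, A (u 0) &
        A `<=` closure (u @` [set t | 0 <= t])]].

Definition closed_orbit G A : Prop :=
  exists (u : R -> V) (T : R),
    [/\ solution G u, 0 < T, forall t, u (t + T) = u t,
        exists t, u t != u 0 & A = range u].

Definition limit_cycle G A : Prop :=
  closed_orbit G A /\
  exists O : set V, [/\ open O, A `<=` O &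
    forall A', closed_orbit G A' -> A' `&` O !=set0 -> A' = A].

Definition stable_limit_cycle G A : Prop :=
  limit_cycle G A /\ asymptotically_stable G A.

(* Nearby orbits spiral towards A as t tends to -oo; semistable cycles are
   neither stable nor unstable. *)
Definition unstable_limit_cycle G A : Prop :=
  limit_cycle G A /\ asymptotically_stable (fun w => - G w) A.

Definition stable_fixed_point G (w : V) : Prop :=
  G w = 0 /\ asymptotically_stable G [set w].

(* The bounded components of the complement of A; A itself is excluded. *)
Definition inside A : set V :=
  [set w | (~` A) w /\ bounded_set (connected_component (~` A) w)].

End Dynamics.

Section Plane.
Context {R : realType}.
Local Notation plane := 'cV[R]_2.
Implicit Types (F : plane -> plane) (gs : set plane).

Definition basis_vec (j : 'I_2) : plane := delta_mx j 0.

Fixpoint Ck (k : nat) (h : plane -> R) : Prop :=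
  if k is k'.+1 then
    continuous h /\
    forall j : 'I_2, (forall z, derivable h z (basis_vec j)) /\
                     Ck k' (fun z => 'D_(basis_vec j) h z)
  else continuous h.

Definition smooth F : Prop :=
  forall (k : nat) (i : 'I_2), Ck k (fun z => F z i 0).

(* Entry (i, j) is the derivative of F_i with respect to the j-th variable;
   the library's jacobian follows the row-vector, i.e. transposed, convention. *)
Definition DF F (z : plane) : 'M[R]_2 :=
  \matrix_(i, j) 'D_(basis_vec j) (fun w => F w i 0) z.

Definition negative_definite (A : 'M[R]_2) : Prop :=
  forall v : plane, v != 0 ->
    (v^T *m (2%:R^-1 *: (A + A^T)) *m v) 0 0 < 0.

Definition D_set F (rho : R) : set plane :=
  [set z | negative_definite (- (rho%:M + DF F z))].

(* (q1, q2) |-> (q1, 0) *)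
Definition tildeq (q : plane) : plane :=
  \col_i (if i == 0 then q i 0 else 0).

Definition star_field F (rho : R) (w : plane * plane) : plane * plane :=
  (F w.1 + tildeq w.2, - ((rho%:M + (DF F w.1)^T) *m w.2)).

Definition standing_setting F gs : Prop :=
  [/\ smooth F,
      [/\ stable_fixed_point F 0, stable_limit_cycle F gs & inside gs 0],
      forall A : set plane, attractor F A <-> A = [set 0] \/ A = gs,
      closure (basin F gs `|` basin F [set 0]) = setT &
      exists! gu : set plane,
        [/\ unstable_limit_cycle F gu, gu `<=` inside gs & inside gu 0]].

End Plane.

(* Main.v *)
Require Import Defs.
From HB Require Import structures.
From mathcomp Require Import all_boot all_order all_algebra.
From mathcomp Require Import all_classical all_reals all_analysis.
From mathcomp Require Import ring lra.
Import Order.TTheory GRing.Theory Num.Theory.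
Import numFieldNormedType.Exports.
Local Open Scope classical_set_scope.
Local Open Scope ring_scope.

(** The origin of the four-dimensional system attracts a neighbourhood: near
    [z = 0] the matrix [rho I + D_F] is definite, so [q] decays exponentially,
    and the planar dynamics, which is asymptotically stable, absorbs a small
    decaying perturbation ([star_attracts]). Hence for a small [d] every point
    of the loop [z = 0], [q = d (cos a, sin a)] flows to the origin. It suffices
    that the backward orbit of some point of the loop meets the stable cycle:
    [U] can then be the singleton of a point where it does.

    Suppose that no backward orbit of the loop meets the cycle. By
    connectedness [z] stays, for all negative times, in the component of the
    complement of the cycle that contains [0] ([backward_orbit_component]).
    This component is bounded and contained in the set [D_rho], so [|q|] grows
    backwards in time. Three facts are contradictory.

    - [|q|] is unbounded along every such orbit ([energy_unbounded]). On the
      boundary of the component [rho I + D_F] may degenerate, so the growth of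
      [|q|] cannot be read off from definiteness. Instead, the system has the
      form [z' = dH/dq], [q' = - dH/dz - rho q] with
      [H = q . F(z) + q1 ^ 2 / 2], so that [expR (rho t) * H] is nonincreasing,
      with derivative [- rho / 2 * expR (rho t) * q1 ^ 2]. At time [0] we have
      [F(z) = 0], so [H >= 0]. If [H] is positive at some negative time it
      grows exponentially backwards, and so [|q|] is unbounded. Otherwise [q1]
      is identically zero, [z] remains at the equilibrium [0], and
      definiteness at that single point suffices.

    - Once [|q|] is large, [q2] cannot vanish ([trapped_step]): a large
      horizontal [q] stays large and nearly horizontal for a fixed time,
      during which it drives [x] out of the bounded component.

    - As [a] runs over a period, the direction of [q] makes one full turn at
      time [0], hence at every negative time, because [q] is never zero and
      depends continuously on [a]. So [q2] vanishes for some [a]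
      ([winds_once_meets_axis]). The angle is followed through short time
      steps, during each of which [q] turns by less than a right angle
      ([winds_once_acute]).

    Compactness of the loop provides one time at which [|q|] is large for all
    [a] ([loop_not_trapped]). *)

(** * Differential inequalities on the real line *)

Section RealCalculus.
Context {R : realType}.
Implicit Types (h dh : R -> R) (a b s t : R).

Lemma is_derive_continuous {h : R -> R} {t d : R} :
  is_derive t 1 h d -> {for t, continuous h}.
Proof.
by move=> hd; apply/differentiable_continuous/derivable1_diffP.
Qed.

Lemma mean_value {h dh : R -> R} {a b : R} :
  (forall t, is_derive t 1 h (dh t)) -> a <= b ->
  exists c, [/\ a <= c, c <= b & h b - h a = dh c * (b - a)].
Proof.
move=> hd ab.
have hc : {within `[a, b], continuous h}.
  apply: continuous_subspaceT => t; exact: is_derive_continuous (hd t).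
have [c cab e] := MVT_segment ab (fun t _ => hd t) hc.
by exists c; move: cab; rewrite in_itv/= => /andP[? ?]; split.
Qed.

Lemma derive_le0_decreasing {h dh : R -> R} {a b : R} :
  (forall t, is_derive t 1 h (dh t)) -> (forall t, a <= t <= b -> dh t <= 0) ->
  a <= b -> h b <= h a.
Proof.
move=> hd d0 ab; have [c [ac cb e]] := mean_value hd ab.
rewrite -subr_le0 e mulr_le0_ge0 ?subr_ge0//.
by apply: d0; rewrite ac cb.
Qed.

Lemma is_derive_opp_time {h : R -> R} {t d : R} :
  is_derive (- t) 1 h d -> is_derive t 1 (fun s => h (- s)) (- d).
Proof.
move=> hd.
have -> : (fun s => h (- s)) = h \o -%R by [].
have -> : - d = d * (- 1) by rewrite mulrN1.
exact: is_derive1_comp.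
Qed.

Lemma is_derive_shift_time {h : R -> R} {t d : R} (s : R) :
  is_derive (t + s) 1 h d -> is_derive t 1 (fun t' => h (t' + s)) d.
Proof.
move=> hd.
have -> : (fun t' => h (t' + s)) = h \o (fun t' => t' + s) by [].
have -> : d = d * 1 by rewrite mulr1.
apply: is_derive1_comp.
by have := is_deriveD (is_derive_id t 1) (is_derive_cst s t 1); rewrite addr0.
Qed.

Lemma is_derive_expRM (k t : R) :
  is_derive t 1 (fun s : R => expR (k * s)) (expR (k * t) * k).
Proof.
have -> : (fun s : R => expR (k * s)) = expR \o (fun s => k * s) by [].
apply: is_derive1_comp.
have {2}-> : k = k *: (1 : R) by rewrite /GRing.scale/= mulr1.
exact: (is_deriveZ _ (is_derive_id t 1)).
Qed.

(** The integrating factor [expR (- K * t)] turns the differential inequality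
    into monotonicity. *)
Lemma gronwall {h dh : R -> R} {K T : R} :
  (forall t, is_derive t 1 h (dh t)) ->
  (forall t, 0 <= t <= T -> dh t <= K * h t) ->
  0 <= T -> h T <= h 0 * expR (K * T).
Proof.
move=> hd hK T0.
pose g t := h t * expR (- K * t).
have gd t : is_derive t 1 g ((dh t - K * h t) * expR (- K * t)).
  have -> : (dh t - K * h t) * expR (- K * t) =
     h t *: (expR (- K * t) * - K) + expR (- K * t) *: dh t.
    by rewrite /GRing.scale/=; ring.
  exact: (is_deriveM (hd t) (is_derive_expRM _ _)).
have := derive_le0_decreasing gd _ T0.
rewrite /g mulr0 expR0 mulr1 => H.
have {}H : h T * expR (- K * T) <= h 0.
  apply: H => t tT; rewrite mulr_le0_ge0 ?expR_ge0// subr_le0; exact: hK.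
have E : h T = h T * expR (- K * T) * expR (K * T).
  by rewrite -mulrA -expRD mulNr addNr expR0 mulr1.
by rewrite E ler_wpM2r// expR_ge0.
Qed.

(** A continuous function cannot reach the level [c] if being below [c] up to
    a time keeps it strictly below [c] at that time: consider the first
    time at which the level is reached. *)
Lemma stays_below {h : R -> R} {c T : R} :
  continuous h -> h 0 < c ->
  (forall t, 0 <= t <= T -> (forall s, 0 <= s <= t -> h s <= c) -> h t < c) ->
  forall t, 0 <= t <= T -> h t < c.
Proof.
move=> hc h0 step t tT; rewrite ltNge; apply/negP => ht.
pose A := `[0, t] `&` h @^-1` [set x | c <= x].
have cA : compact A.
  apply: (subclosed_compact _ (segment_compact (a := 0) (b := t))); last first.
    by move=> x [].
  apply: closedI; first exact: interval_closed.
  exact: (continuous_closedP h).1 hc _ (@closed_ge _ c).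
have A0 : A !=set0.
  by exists t; split => //=; rewrite in_itv/= lexx andbT; case/andP: tT.
have [s sA smin] : exists2 s, s \in A & forall u, u \in A -> s <= u.
  apply: (compact_EVT_min (f := id) A0 cA).
  by apply: continuous_subspaceT => x; exact: cvg_id.
move: sA; rewrite inE => -[/=]; rewrite in_itv/= => /andP[s0 st] cs.
have [u u0s hu] : exists2 u, u \in `[0, s] & h u = c.
  apply: IVT => //; first by apply: continuous_subspaceT => x; exact: hc.
  have h0s : h 0 <= h s by rewrite (le_trans (ltW h0)).
  by rewrite (min_idPl h0s) (max_idPr h0s) (ltW h0) cs.
move: u0s; rewrite in_itv/= => /andP[u0 us].
have us' : s = u.
  apply/eqP; rewrite eq_le us andbT; apply: smin; rewrite inE; split => /=.
    by rewrite in_itv/= u0 (le_trans us).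
  by rewrite hu.
have : h s < c.
  apply: step; first by rewrite s0; case/andP: tT => _; apply: le_trans.
  move=> v /andP[v0 vs]; rewrite leNgt; apply/negP => cv.
  have sv : s <= v.
    apply: smin; rewrite inE; split => /=; last exact: ltW.
    by rewrite in_itv/= v0 (le_trans vs).
  have vE : v = s by apply/eqP; rewrite eq_le vs sv.
  by move: cv; rewrite vE us' hu ltxx.
by rewrite ltNge cs.
Qed.

End RealCalculus.

(** * Continuously differentiable functions of two variables *)

Section PlanarFunctions.
Context {R : realType}.
Implicit Types (h hx hy : R -> R -> R) (a b s t : R).

Definition C1 h hx hy : Prop :=
  [/\ forall a b, is_derive a 1 (h ^~ b) (hx a b),
      forall a b, is_derive b 1 (h a) (hy a b),
      continuous (fun z : R * R => hx z.1 z.2) &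
      continuous (fun z : R * R => hy z.1 z.2)].

Definition locally_lipschitz2 h : Prop :=
  forall M : R, exists2 L : R, 0 <= L &
    forall a b a' b', `|a| <= M -> `|b| <= M -> `|a'| <= M -> `|b'| <= M ->
    `|h a b - h a' b'| <= L * (`|a - a'| + `|b - b'|).

Lemma continuous2_bounded {h} : continuous (fun z : R * R => h z.1 z.2) ->
  forall M : R, exists2 K : R, 0 <= K &
    forall a b, `|a| <= M -> `|b| <= M -> `|h a b| <= K.
Proof.
move=> hc M.
have [M0|M0] := ltP M 0.
  by exists 0 => // a b aM; move: (le_trans (normr_ge0 a) aM); rewrite leNgt M0.
pose A : set (R * R) := `[- M, M] `*` `[- M, M].
have cA : compact A by apply: compact_setX; exact: segment_compact.
have A0 : A !=set0 by exists (0, 0); split; rewrite /= in_itv/= oppr_le0 M0.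
have [z zA zmax] := compact_EVT_max A0 cA (f := fun z => `|h z.1 z.2|)
  (continuous_subspaceT (fun x => continuous_comp (hc x) (@norm_continuous _ _ _))).
exists `|h z.1 z.2| => // a b aM bM.
by apply: (zmax (a, b)); rewrite inE; split; rewrite /= in_itv/= -ler_norml.
Qed.

Lemma mean_value_abs (k dk : R -> R) (a b K M : R) :
  (forall t, is_derive t 1 k (dk t)) ->
  (forall t, `|t| <= M -> `|dk t| <= K) -> `|a| <= M -> `|b| <= M ->
  `|k a - k b| <= K * `|a - b|.
Proof.
move=> kd kK; wlog ab : a b / a <= b.
  move=> W aM bM; have [ab|/ltW ba] := leP a b; first exact: W.
  by rewrite distrC (distrC a); apply: W.
move=> aM bM; have [c [ac cb e]] := mean_value kd ab.
rewrite distrC e normrM (distrC b) ler_wpM2r//; apply: kK.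
by rewrite ler_norml; move: aM bM; rewrite !ler_norml => /andP[? ?] /andP[? ?];
   apply/andP; split; lra.
Qed.

(** Moving one coordinate at a time stays inside the box, so the partial
    derivatives only need to be bounded there. *)
Lemma C1_lipschitz {h hx hy} : C1 h hx hy -> locally_lipschitz2 h.
Proof.
move=> [dx dy cx cy] M.
have [Kx Kx0 hKx] := continuous2_bounded cx M.
have [Ky Ky0 hKy] := continuous2_bounded cy M.
exists (Kx + Ky); first by rewrite addr_ge0.
move=> a b a' b' aM bM a'M b'M.
have e1 : `|h a b - h a' b| <= Kx * `|a - a'|.
  by apply: (mean_value_abs (h ^~ b) (hx ^~ b) _ _ _ M) => // t tM; exact: hKx.
have e2 : `|h a' b - h a' b'| <= Ky * `|b - b'|.
  by apply: (mean_value_abs (h a') (hy a') _ _ _ M) => // t tM; exact: hKy.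
have -> : h a b - h a' b' = (h a b - h a' b) + (h a' b - h a' b') by ring.
apply: (le_trans (ler_normD _ _)).
have := normr_ge0 (a - a'); have := normr_ge0 (b - b').
by move: e1 e2; nra.
Qed.

(** The increment of [h] is split into a horizontal and a vertical one, and
    the slope of the horizontal one is a value of [hx] at a nearby point;
    this gives the Caratheodory slope of the composite. *)
Lemma C1_chain {h hx hy} {x y : R -> R} {t dx dy : R} : C1 h hx hy ->
  is_derive t 1 x dx -> is_derive t 1 y dy ->
  is_derive t 1 (fun s => h (x s) (y s)) (hx (x t) (y t) * dx + hy (x t) (y t) * dy).
Proof.
move=> [hdx hdy cx _] xd yd.
have [X [XE Xc Xt]] := (is_derive1_caratheodory x t dx).1 xd.
have [Y [YE Yc Yt]] := (is_derive1_caratheodory y t dy).1 yd.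
have [V [VE Vc Vt]] := (is_derive1_caratheodory _ _ _).1 (hdy (x t) (y t)).
pose S s := if x s == x t then hx (x t) (y s)
            else (h (x s) (y s) - h (x t) (y s)) / (x s - x t).
have SE s : h (x s) (y s) - h (x t) (y s) = S s * (x s - x t).
  rewrite /S; case: eqP => [->|/eqP]; first by rewrite !subrr mulr0.
  by rewrite -subr_eq0 => /divfK ->.
have xc := is_derive_continuous xd.
have yc := is_derive_continuous yd.
have Smid s : exists c, `|c - x t| <= `|x s - x t| /\ S s = hx c (y s).
  rewrite /S; case: eqP => [e|/eqP ne].
    by exists (x t); rewrite subrr normr0 normr_ge0.
  have [le|/ltW le] := leP (x t) (x s).
    have [c [c1 c2 e]] := mean_value (fun a => hdx a (y s)) le.
    exists c; split; first by rewrite !ger0_norm ?subr_ge0// lerB.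
    by rewrite e mulfK// subr_eq0.
  have [c [c1 c2 e]] := mean_value (fun a => hdx a (y s)) le.
  exists c; split; first by rewrite !ler0_norm ?subr_le0// lerN2 lerB.
  by rewrite -(opprB (h (x t) _)) e -mulrN opprB mulfK// subr_eq0.
have Sc : {for t, continuous S}.
  have St : S t = hx (x t) (y t) by rewrite /S eqxx.
  apply/cvgrPdist_lt => e e0.
  have /cvgrPdist_lt/(_ e e0)/nbhs_ballP[d /= d0 hd] := cx (x t, y t).
  have /cvgrPdist_lt/(_ d d0) hxs := xc.
  have /cvgrPdist_lt/(_ d d0) hys := yc.
  near=> s.
  have [c [cd ->]] := Smid s; rewrite St.
  apply: (hd (c, y s)); split; rewrite /ball/=; last by near: s.
  by rewrite distrC (le_lt_trans cd)// distrC; near: s.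
apply/is_derive1_caratheodory.
exists (fun s => S s * X s + V (y s) * Y s); split.
- move=> s.
  have -> : h (x s) (y s) - h (x t) (y t) =
    (h (x s) (y s) - h (x t) (y s)) + (h (x t) (y s) - h (x t) (y t)) by ring.
  by rewrite SE VE XE YE; ring.
- apply: cvgD; first exact: cvgM.
  by apply: cvgM => //; apply: (continuous_comp yc).
- by rewrite Xt Yt Vt /S eqxx.
Unshelve. all: by end_near. Qed.

End PlanarFunctions.

(** * Continuous dependence of solutions on initial conditions *)

Section Ode.
Context {R : realType} {I : finType}.
Implicit Types (G : (I -> R) -> I -> R) (u v : I -> R -> R) (s t : R).

Definition ode G u : Prop :=
  forall t i, is_derive t 1 (u i) (G (u ^~ t) i).

Definition locally_lipschitz G : Prop :=
  forall M : R, exists2 L : R, 0 <= L &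
    forall a b d, (forall i, `|a i| <= M) -> (forall i, `|b i| <= M) ->
      (forall i, `|a i - b i| <= d) -> forall i, `|G a i - G b i| <= L * d.

Lemma ode_continuous {G u} : ode G u -> forall i, continuous (u i).
Proof. by move=> ou i t; exact: is_derive_continuous (ou t i). Qed.

Lemma ode_shift {G u} s : ode G u -> ode G (fun i t => u i (t + s)).
Proof. by move=> ou t i; apply: is_derive_shift_time; exact: ou. Qed.

Lemma ode_reverse {G u} :
  ode G u -> ode (fun a i => - G a i) (fun i t => u i (- t)).
Proof. by move=> ou t i; apply: is_derive_opp_time; exact: ou. Qed.

Lemma locally_lipschitz_opp {G} :
  locally_lipschitz G -> locally_lipschitz (fun a i => - G a i).
Proof.
move=> lG M; have [L L0 hL] := lG M; exists L => // a b d aM bM ab i.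
by rewrite -normrN opprB opprK addrC; exact: hL.
Qed.

Lemma ode_bounded {G u} T : ode G u ->
  exists M, forall i t, 0 <= t <= T -> `|u i t| <= M.
Proof.
move=> ou; have [T0|T0] := ltP T 0.
  exists 0 => i t /andP[t0 tT]; move: (le_trans t0 tT); by rewrite leNgt T0.
have b i : exists M, forall t, 0 <= t <= T -> `|u i t| <= M.
  have [c _ hc] := EVT_max (f := fun t => `|u i t|) T0
    (continuous_subspaceT (fun x => continuous_comp (ode_continuous ou i x)
      (@norm_continuous _ _ _))).
  by exists `|u i c| => t tT; apply: hc; rewrite in_itv.
have {}b i := cid (b i).
exists (\sum_i `|sval (b i)|) => i t tT.
rewrite (bigD1 i)//= ler_wpDr ?sumr_ge0//.
exact: (le_trans (svalP (b i) t tT) (ler_norm _)).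
Qed.

Definition sqdist u v t := \sum_i (u i t - v i t) ^+ 2.

Lemma sqdist_derive {G u v} : ode G u -> ode G v -> forall t,
  is_derive t 1 (sqdist u v)
    (\sum_i 2 * (u i t - v i t) * (G (u ^~ t) i - G (v ^~ t) i)).
Proof.
move=> ou ov t.
have -> : sqdist u v = \sum_i (fun s => (u i s - v i s) ^+ 2).
  by apply/funext => s; rewrite /sqdist fct_sumE.
elim/big_ind2 : _ => [|f df g dg fd gd|i _]; first exact: is_derive_cst.
  exact: is_deriveD.
have H := is_deriveB (ou t i) (ov t i).
apply: (is_derive_eq (is_deriveX 2 H)).
by rewrite /GRing.scale/= expr1 mulr_natl.
Qed.

Lemma sqdist_ge u v t i : (u i t - v i t) ^+ 2 <= sqdist u v t.
Proof.
rewrite /sqdist (bigD1 i)//= ler_wpDr// sumr_ge0// => j _; exact: sqr_ge0.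
Qed.

Lemma sqdist_growth {G u v M L T} : ode G u -> ode G v -> 0 <= L ->
  (forall a b d, (forall i, `|a i| <= M) -> (forall i, `|b i| <= M) ->
      (forall i, `|a i - b i| <= d) -> forall i, `|G a i - G b i| <= L * d) ->
  (forall i t, 0 <= t <= T -> `|u i t| <= M) ->
  (forall i t, 0 <= t <= T -> `|v i t| <= M) -> 0 <= T ->
  sqdist u v T <= sqdist u v 0 * expR (2 * L * #|I|%:R * T).
Proof.
move=> ou ov L0 hL uM vM T0.
apply: (gronwall (sqdist_derive ou ov)) => // t tT.
set D := sqdist u v t.
have D0 : 0 <= D by apply: sumr_ge0 => i _; exact: sqr_ge0.
have uvD i : `|u i t - v i t| <= Num.sqrt D.
  by rewrite -sqrtr_sqr ler_wsqrtr// sqdist_ge.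
have -> : 2 * L * #|I|%:R * D = \sum_(i : I) 2 * (L * D).
  by rewrite sumr_const -mulr_natl; ring.
apply: ler_sum => i _.
have H1 := uvD i.
have H2 := hL (u ^~ t) (v ^~ t) _ (fun i => uM i t tT) (fun i => vM i t tT) uvD i.
rewrite -mulrA ler_pM2l//.
apply: (le_trans (ler_norm _)); rewrite normrM.
have -> : L * D = Num.sqrt D * (L * Num.sqrt D).
  by rewrite -{1}(sqr_sqrtr D0); ring.
exact: ler_pM.
Qed.

(** A solution starting close enough to a bounded one cannot leave the unit
    neighbourhood of the latter before the time horizon: as long as it stays
    there, the Lipschitz constant of a fixed box controls its distance. *)
Lemma continuous_dependence {G} M T e : locally_lipschitz G -> 0 <= T -> 0 < e ->
  exists2 d : R, 0 < d & forall u v, ode G u -> ode G v ->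
    (forall i t, 0 <= t <= T -> `|u i t| <= M) ->
    (forall i, `|u i 0 - v i 0| < d) ->
    forall i t, 0 <= t <= T -> `|u i t - v i t| < e.
Proof.
move=> lG T0 e0.
have [L L0 hL] := lG (M + 1).
pose c := Num.min 1 e.
have c0 : 0 < c by rewrite lt_min ltr01.
pose n : R := #|I|%:R.
pose A := expR (2 * L * n * T).
have A1 : 1 <= A by rewrite -expR0 ler_expR !mulr_ge0// ler0n.
have n0 : 0 <= n by rewrite ler0n.
have nA0 : 0 < n * A + 1 by rewrite ltr_wpDl// mulr_ge0// (le_trans ler01).
exists (Num.min 1 (c ^+ 2 / (n * A + 1))).
  by rewrite lt_min ltr01 divr_gt0// exprn_gt0.
move=> u v ou ov uM uv0.
set d := Num.min _ _ in uv0.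
have d0 : 0 < d by rewrite lt_min ltr01 divr_gt0// exprn_gt0.
have d1 : d <= 1 by rewrite ge_min lexx.
have d2 : d * (n * A + 1) <= c ^+ 2 by rewrite -ler_pdivlMr// ge_min lexx orbT.
have start : sqdist u v 0 <= n * d.
  have -> : n * d = \sum_(i : I) d by rewrite sumr_const -mulr_natl.
  apply: ler_sum => i _; rewrite -real_normK ?num_real// expr2.
  have := uv0 i; have := normr_ge0 (u i 0 - v i 0); nra.
have start0 : 0 <= sqdist u v 0 by apply: sumr_ge0 => i _; exact: sqr_ge0.
have ndA : n * d * A < c ^+ 2 by apply: lt_le_trans d2; nra.
have small t : 0 <= t <= T -> sqdist u v t < c ^+ 2.
  apply: stays_below.
  - by move=> s; exact: is_derive_continuous (sqdist_derive ou ov s).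
  - by apply: (le_lt_trans start); apply: le_lt_trans ndA; rewrite ler_peMr// mulr_ge0// ltW.
  - move=> {}t /andP[t0 tT] below.
    have uvs i s : 0 <= s <= t -> `|u i s - v i s| <= 1.
      move=> st; have : `|u i s - v i s| ^+ 2 <= c ^+ 2.
        rewrite real_normK ?num_real// (le_trans (sqdist_ge _ _ _ _))//.
        exact: below.
      rewrite ler_pXn2r ?nnegrE// ?(ltW c0)// => /le_trans; apply.
      by rewrite ge_min lexx.
    have uMt i s : 0 <= s <= t -> `|u i s| <= M.
      by move=> /andP[s0 st]; apply: uM; rewrite s0 (le_trans st).
    have vMt i s : 0 <= s <= t -> `|v i s| <= M + 1.
      move=> st; have -> : v i s = u i s - (u i s - v i s) by ring.
      by rewrite (le_trans (ler_normB _ _))// lerD ?uMt ?uvs.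
    have uMt1 i s : 0 <= s <= t -> `|u i s| <= M + 1.
      by move=> st; rewrite (le_trans (uMt _ _ st))// lerDl.
    apply: (le_lt_trans (sqdist_growth ou ov L0 hL uMt1 vMt t0)).
    apply: le_lt_trans ndA; apply: ler_pM => //.
    by rewrite ler_expR ler_wpM2l// !mulr_ge0.
move=> i t tT.
have : `|u i t - v i t| ^+ 2 < c ^+ 2.
  by rewrite real_normK ?num_real// (le_lt_trans (sqdist_ge _ _ _ _))// small.
rewrite ltr_pXn2r ?nnegrE// ?(ltW c0)// => /lt_le_trans; apply.
by rewrite ge_min lexx orbT.
Qed.

Lemma ode_unique {G u v} : locally_lipschitz G -> ode G u -> ode G v ->
  (forall i, u i 0 = v i 0) -> forall t i, 0 <= t -> u i t = v i t.
Proof.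
move=> lG ou ov uv0 t i t0.
have [M uM] := ode_bounded t ou.
apply/eqP; rewrite -subr_eq0 -normr_le0; apply/ler_addgt0Pl => e e0.
have [d d0 hd] := continuous_dependence M t e lG t0 e0.
rewrite addr0 ltW//; apply: (hd u v) => //; last by rewrite t0 lexx.
by move=> j; rewrite uv0 subrr normr0.
Qed.

End Ode.

(** * Winding of planar loops *)

Section Winding.
Context {R : realType}.
Implicit Types (X Y : R -> R) (s t : R).

(** The winding number around the origin is one. Giving the polar form of the
    loop makes the intermediate value theorem the only tool needed. *)
Definition winds_once X Y : Prop :=
  exists a r : R -> R,
    [/\ continuous a, a (pi *+ 2) = a 0 + pi *+ 2 &
        forall t, [/\ 0 < r t, X t = r t * cos (a t) & Y t = r t * sin (a t)]].

Lemma circle_winds_once e : 0 < e ->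
  winds_once (fun t => e * cos t) (fun t => e * sin t).
Proof.
move=> e0; exists id, (fun=> e); split => //; first by move=> t; exact: cvg_id.
by rewrite add0r.
Qed.

(** The quotient of the two loops, as complex numbers, has a positive real
    part, so that its principal argument is continuous. *)
Lemma winds_once_acute {X Y X' Y' : R -> R} :
  continuous X -> continuous Y -> continuous X' -> continuous Y' ->
  X (pi *+ 2) = X 0 -> Y (pi *+ 2) = Y 0 ->
  X' (pi *+ 2) = X' 0 -> Y' (pi *+ 2) = Y' 0 ->
  (forall t, 0 < X t * X' t + Y t * Y' t) ->
  winds_once X Y -> winds_once X' Y'.
Proof.
move=> cX cY cX' cY' pX pY pX' pY' acute [a [r [ac a2 ar]]].
pose D t := X t * X' t + Y t * Y' t.
pose C t := X t * Y' t - Y t * X' t.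
pose b t := atan (C t / D t).
pose k t := D t / (r t ^+ 2 * cos (b t)).
have cb t : 0 < cos (b t).
  by apply: cos_gt0_pihalf; rewrite atan_gtNpi2 atan_ltpi2.
exists (fun t => a t + b t), (fun t => r t * k t); split.
- move=> t; apply: cvgD; first exact: ac.
  apply: continuous_comp; last exact: continuous_atan.
  apply: cvgM; last apply: cvgV; rewrite ?gt_eqF ?acute//.
    apply: cvgB; apply: cvgM; [exact: cX|exact: cY'|exact: cY|exact: cX'].
  apply: cvgD; apply: cvgM; [exact: cX|exact: cX'|exact: cY|exact: cY'].
- by rewrite a2 /b /C /D pX pY pX' pY' addrAC.
- move=> t; have [r0 Xr Yr] := ar t.
  have D0 : 0 < D t := acute t.
  have c0 := cb t.
  have sb : sin (b t) = C t / D t * cos (b t).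
    have := atanK (C t / D t); rewrite /tan -/(b t) => <-.
    by rewrite divfK ?gt_eqF.
  have n2 : cos (a t) ^+ 2 + sin (a t) ^+ 2 = 1 by rewrite cos2sin2 subrK.
  have k0 : 0 < k t by rewrite divr_gt0// mulr_gt0// exprn_gt0.
  have kE : k t * cos (b t) * r t ^+ 2 = D t.
    by rewrite /k; field; rewrite !gt_eqF.
  have kS : k t * sin (b t) * r t ^+ 2 = C t.
    by rewrite sb /k; field; rewrite !gt_eqF.
  split; first exact: mulr_gt0.
  + rewrite cosD; apply: (mulfI (x := r t ^+ 2)); first by rewrite gt_eqF// exprn_gt0.
    have -> : r t ^+ 2 * (r t * k t * (cos (a t) * cos (b t) - sin (a t) * sin (b t)))
       = r t * cos (a t) * (k t * cos (b t) * r t ^+ 2)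
       - r t * sin (a t) * (k t * sin (b t) * r t ^+ 2) by ring.
    rewrite kE kS /C /D Xr Yr -[LHS]mul1r -n2; ring.
  + rewrite sinD; apply: (mulfI (x := r t ^+ 2)); first by rewrite gt_eqF// exprn_gt0.
    have -> : r t ^+ 2 * (r t * k t * (sin (a t) * cos (b t) + cos (a t) * sin (b t)))
       = r t * sin (a t) * (k t * cos (b t) * r t ^+ 2)
       + r t * cos (a t) * (k t * sin (b t) * r t ^+ 2) by ring.
    rewrite kE kS /C /D Xr Yr -[LHS]mul1r -n2; ring.
Qed.

(** Half a turn after the initial argument, the direction is opposite to the
    initial one, and [Y] vanishes somewhere in between. *)
Lemma winds_once_meets_axis {X Y : R -> R} : continuous Y -> winds_once X Y ->
  exists2 t, 0 <= t <= pi *+ 2 & Y t = 0.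
Proof.
move=> cY [a [r [ac a2 ar]]].
have p0 : 0 <= pi *+ 2 :> R by rewrite mulrn_wge0// pi_ge0.
have [t tI at_] : exists2 t, t \in `[0, pi *+ 2] & a t = a 0 + pi.
  apply: IVT => //; first by apply: continuous_subspaceT => x; exact: ac.
  have h : a 0 <= a (pi *+ 2) by rewrite a2 lerDl.
  by rewrite (min_idPl h) (max_idPr h) a2 lerDl pi_ge0 lerD2l mulr2n lerDl pi_ge0.
move: tI; rewrite in_itv/= => /andP[t0 t2].
have [c cI Yc] : exists2 c, c \in `[0, t] & Y c = 0.
  apply: IVT => //; first by apply: continuous_subspaceT => x; exact: cY.
  have [r0 _ ->] := ar 0; have [rt _ ->] := ar t.
  rewrite at_ sinDpi mulrN.
  have [s0|s0] := leP 0 (sin (a 0)).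
    have le1 : 0 <= r 0 * sin (a 0) by rewrite mulr_ge0// ltW.
    have le2 : - (r t * sin (a 0)) <= 0 by rewrite oppr_le0 mulr_ge0// ltW.
    by rewrite minC maxC (min_idPl (le_trans le2 le1)) (max_idPr (le_trans le2 le1)) le2.
  have le1 : r 0 * sin (a 0) <= 0 by rewrite mulr_ge0_le0// ltW.
  have le2 : 0 <= - (r t * sin (a 0)) by rewrite oppr_ge0 mulr_ge0_le0// ltW.
  by rewrite (min_idPl (le_trans le1 le2)) (max_idPr (le_trans le1 le2)) le1.
exists c => //; move: cI; rewrite in_itv/= => /andP[-> ct].
exact: le_trans ct t2.
Qed.

End Winding.

(** * The four-dimensional system in coordinates *)

(** The coordinates [x], [y], [q1], [q2] of a state are indexed by pairs of
    booleans, a finite type on which case analysis computes. *)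
Local Notation ix := (false, false).
Local Notation iy := (false, true).
Local Notation ip := (true, false).
Local Notation iq := (true, true).

Section StarSystem.
Context {R : realType}.
Context {f g fx fy gx gy : R -> R -> R} {rho : R}.
Context (Cf : C1 f fx fy) (Cg : C1 g gx gy).
Context (Lfx : locally_lipschitz2 fx) (Lfy : locally_lipschitz2 fy).
Context (Lgx : locally_lipschitz2 gx) (Lgy : locally_lipschitz2 gy).
Implicit Types (u v : bool * bool -> R -> R) (s t x y p q : R).

Definition star (w : bool * bool -> R) (i : bool * bool) : R :=
  match i with
  | (false, false) => f (w ix) (w iy) + w ip
  | (false, true) => g (w ix) (w iy)
  | (true, false) => - ((rho + fx (w ix) (w iy)) * w ip + gx (w ix) (w iy) * w iq)
  | (true, true) => - (fy (w ix) (w iy) * w ip + (rho + gy (w ix) (w iy)) * w iq)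
  end.

Lemma common_lipschitz (M : R) : exists2 L : R, 0 <= L &
  forall h, h = f \/ h = g \/ h = fx \/ h = fy \/ h = gx \/ h = gy ->
  (forall a b, `|a| <= M -> `|b| <= M -> `|h a b| <= L) /\
  (forall a b a' b' d, `|a| <= M -> `|b| <= M -> `|a'| <= M -> `|b'| <= M ->
    `|a - a'| <= d -> `|b - b'| <= d -> `|h a b - h a' b'| <= L * d).
Proof.
have H (h : R -> R -> R) : locally_lipschitz2 h -> exists2 L : R, 0 <= L &
  (forall a b, `|a| <= M -> `|b| <= M -> `|h a b| <= L) /\
  (forall a b a' b' d, `|a| <= M -> `|b| <= M -> `|a'| <= M -> `|b'| <= M ->
    `|a - a'| <= d -> `|b - b'| <= d -> `|h a b - h a' b'| <= L * d).
  move=> /(_ M)[L L0 hL]; exists (`|h 0 0| + 2 * L * `|M| + 2 * L).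
    by rewrite !addr_ge0// !mulr_ge0.
  split=> [a b aM bM|a b a' b' d aM bM a'M b'M ad bd].
    have M0 : 0 <= M := le_trans (normr_ge0 _) aM.
    have H0 : `|0 : R| <= M by rewrite normr0.
    have := hL a b 0 0 aM bM H0 H0; rewrite !subr0 => h1.
    have -> : h a b = h 0 0 + (h a b - h 0 0) by ring.
    apply: (le_trans (ler_normD _ _)); rewrite (ger0_norm M0).
    nra.
  apply: (le_trans (hL _ _ _ _ aM bM a'M b'M)).
  have d0 : 0 <= d := le_trans (normr_ge0 _) ad.
  have : 0 <= (`|h 0 0| + 2 * L * `|M|) * d by rewrite mulr_ge0// addr_ge0// !mulr_ge0.
  nra.
have [L1 L10 [B1 D1]] := H f (C1_lipschitz Cf).
have [L2 L20 [B2 D2]] := H g (C1_lipschitz Cg).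
have [L3 L30 [B3 D3]] := H fx Lfx.
have [L4 L40 [B4 D4]] := H fy Lfy.
have [L5 L50 [B5 D5]] := H gx Lgx.
have [L6 L60 [B6 D6]] := H gy Lgy.
exists (L1 + L2 + L3 + L4 + L5 + L6); first by rewrite !addr_ge0.
move=> h h6; suff [L [L0 LL Bh Dh]] : exists L : R, [/\ 0 <= L,
    L <= L1 + L2 + L3 + L4 + L5 + L6,
    (forall a b, `|a| <= M -> `|b| <= M -> `|h a b| <= L) &
    (forall a b a' b' d, `|a| <= M -> `|b| <= M -> `|a'| <= M -> `|b'| <= M ->
    `|a - a'| <= d -> `|b - b'| <= d -> `|h a b - h a' b'| <= L * d)].
  split=> [a b aM bM|a b a' b' d aM bM a'M b'M ad bd].
    exact: le_trans (Bh _ _ aM bM) LL.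
  apply: (le_trans (Dh _ _ _ _ _ aM bM a'M b'M ad bd)).
  by rewrite ler_wpM2r// (le_trans (normr_ge0 _) ad).
by move: h6 => [->|[->|[->|[->|[->|->]]]]];
  [exists L1|exists L2|exists L3|exists L4|exists L5|exists L6]; split => //; lra.
Qed.

Lemma star_locally_lipschitz : locally_lipschitz star.
Proof.
move=> M; have [L L0 hL] := common_lipschitz M.
exists (2 * L * `|M| + 2 * L + `|rho| + 1).
  by rewrite !addr_ge0// !mulr_ge0.
move=> a b d aM bM ab i.
have d0 : 0 <= d := le_trans (normr_ge0 _) (ab ix).
have M0 : 0 <= M := le_trans (normr_ge0 _) (aM ix).
have LMd : 0 <= L * M * d by rewrite !mulr_ge0.
have Ld : 0 <= L * d by rewrite mulr_ge0.
have rd : 0 <= `|rho| * d by rewrite mulr_ge0.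
have dif h : h = f \/ h = g \/ h = fx \/ h = fy \/ h = gx \/ h = gy ->
    `|h (a ix) (a iy) - h (b ix) (b iy)| <= L * d.
  by move=> /hL[_]; apply.
have prod h j : h = f \/ h = g \/ h = fx \/ h = fy \/ h = gx \/ h = gy ->
    `|h (a ix) (a iy) * a j - h (b ix) (b iy) * b j| <= L * M * d + L * d.
  move=> hh; have [Bh _] := hL h hh.
  have -> : h (a ix) (a iy) * a j - h (b ix) (b iy) * b j =
    (h (a ix) (a iy) - h (b ix) (b iy)) * a j + h (b ix) (b iy) * (a j - b j) by ring.
  apply: (le_trans (ler_normD _ _)); rewrite !normrM lerD//.
    by rewrite mulrAC ler_pM// dif.
  by apply: ler_pM => //; exact: Bh.
have rdif j : `|rho * a j - rho * b j| <= `|rho| * d.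
  by rewrite -mulrBr normrM ler_wpM2l.
have pos := (normr_ge0 rho).
rewrite (ger0_norm M0).
case: i => [[] []] /=.
- have h1 := prod fy ip ltac:(tauto); have h2 := prod gy iq ltac:(tauto).
  have h3 := rdif iq.
  move: h1 h2 h3; rewrite !ler_norml => /andP[? ?] /andP[? ?] /andP[? ?].
  by apply/andP; split; lra.
- have h1 := prod fx ip ltac:(tauto); have h2 := prod gx iq ltac:(tauto).
  have h3 := rdif ip.
  move: h1 h2 h3; rewrite !ler_norml => /andP[? ?] /andP[? ?] /andP[? ?].
  by apply/andP; split; lra.
- have h1 := dif g ltac:(tauto).
  move: h1; rewrite !ler_norml => /andP[? ?].
  by apply/andP; split; lra.
- have h1 := dif f ltac:(tauto).
  have h2 := ab ip.
  move: h1 h2; rewrite !ler_norml => /andP[? ?] /andP[? ?].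
  by apply/andP; split; lra.
Qed.

Definition qform x y p q : R :=
  (rho + fx x y) * p ^+ 2 + (fy x y + gx x y) * (p * q) + (rho + gy x y) * q ^+ 2.

Definition energy u t : R := u ip t ^+ 2 + u iq t ^+ 2.

Lemma energy_derive {u} : ode star u -> forall t,
  is_derive t 1 (energy u) (- 2 * qform (u ix t) (u iy t) (u ip t) (u iq t)).
Proof.
move=> ou t.
have H := is_deriveD (is_deriveX 2 (ou t ip)) (is_deriveX 2 (ou t iq)).
apply: (is_derive_eq H).
by rewrite /GRing.scale/= /qform !expr1; ring.
Qed.

(** The system reads [z' = dH/dq], [q' = - dH/dz - rho q] for this function
    [H = q . F(z) + q1 ^ 2 / 2] of [(z, q)]. *)
Definition hamiltonian u t : R :=
  u ip t * f (u ix t) (u iy t) + u iq t * g (u ix t) (u iy t) + u ip t ^+ 2 / 2.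

(** As in Hamiltonian mechanics, all the terms cancel except the ones coming
    from the friction [- rho q]. *)
Lemma hamiltonian_derive {u} : ode star u -> forall t,
  is_derive t 1 (hamiltonian u) (- rho * (hamiltonian u t + u ip t ^+ 2 / 2)).
Proof.
move=> ou t.
have H1 := is_deriveM (ou t ip) (C1_chain Cf (ou t ix) (ou t iy)).
have H2 := is_deriveM (ou t iq) (C1_chain Cg (ou t ix) (ou t iy)).
have H3 := is_deriveM (is_deriveX 2 (ou t ip)) (is_derive_cst (2^-1 : R) t 1).
have H := is_deriveD (is_deriveD H1 H2) H3.
apply: (is_derive_eq H).
by rewrite /GRing.scale/= /hamiltonian !expr1; field.
Qed.

(** * Attraction of a neighbourhood of the origin *)

Definition definite x y : Prop :=
  forall p q, (p != 0) || (q != 0) -> 0 < qform x y p q.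

(** Definiteness at one point is coercive, and the coefficients of the form
    vary little near that point. *)
Lemma definite_coercive : definite 0 0 -> exists c r : R, [/\ 0 < c, 0 < r &
  forall x y p q, `|x| <= r -> `|y| <= r ->
    c * (p ^+ 2 + q ^+ 2) <= qform x y p q].
Proof.
move=> pd.
pose a := rho + fx 0 0; pose b := fy 0 0 + gx 0 0; pose d := rho + gy 0 0.
have E p q : qform 0 0 p q = a * p ^+ 2 + b * (p * q) + d * q ^+ 2 by [].
(* evaluate the form at [(1, 0)], [(0, 1)] and [(b, - 2 a)] *)
have a0 : 0 < a.
  by have := pd 1 0; rewrite oner_eq0 => /(_ isT); rewrite E; nra.
have d0 : 0 < d.
  by have := pd 0 1; rewrite oner_eq0 orbT => /(_ isT); rewrite E; nra.
have disc : 0 < 4 * a * d - b ^+ 2.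
  have := pd b (- (2 * a)).
  have -> : - (2 * a) != 0 by rewrite oppr_eq0 mulf_neq0// gt_eqF.
  rewrite orbT => /(_ isT); rewrite E => h.
  rewrite -(pmulr_rgt0 _ a0); apply: lt_le_trans h _; rewrite le_eqVlt; apply/orP; left.
  by apply/eqP; ring.
pose c := (4 * a * d - b ^+ 2) / (4 * (a + d)).
have c0 : 0 < c by rewrite divr_gt0// mulr_gt0// addr_gt0.
have cE : 4 * (c * (a + d)) = 4 * a * d - b ^+ 2.
  by rewrite /c; field; rewrite gt_eqF// addr_gt0.
have ca : c < a.
  have : 4 * (c * (a + d)) < 4 * (a * (a + d)) by rewrite cE; nra.
  by rewrite ltr_pM2l// ltr_pM2r// addr_gt0.
(* with this [c], subtracting [c] times the identity from the form leaves a
   form whose discriminant is [- 4 * c ^ 2] *)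
have base p q : c * (p ^+ 2 + q ^+ 2) <= qform 0 0 p q.
  rewrite E -subr_ge0 -(pmulr_rge0 (x := 4 * (a - c))); last first.
    by rewrite mulr_gt0// subr_gt0.
  have -> : 4 * (a - c) * (a * p ^+ 2 + b * (p * q) + d * q ^+ 2 - c * (p ^+ 2 + q ^+ 2))
    = (2 * (a - c) * p + b * q) ^+ 2 + (4 * a * d - b ^+ 2 - 4 * (c * (a + d)) + 4 * c ^+ 2) * q ^+ 2 by ring.
  by rewrite cE subrr add0r addr_ge0 ?sqr_ge0// mulr_ge0 ?sqr_ge0// mulr_ge0 ?sqr_ge0.
have [L L0 hL] := common_lipschitz 1.
pose r := Num.min 1 (c / (4 * (L + 1))).
have L1 : 0 < 4 * (L + 1) by rewrite mulr_gt0// ltr_wpDl.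
have r0 : 0 < r by rewrite lt_min ltr01 divr_gt0.
have r1 : r <= 1 by rewrite ge_min lexx.
have rc : r * (4 * (L + 1)) <= c by rewrite -ler_pdivlMr// ge_min lexx orbT.
exists (c / 2), r; split => //; first by rewrite divr_gt0.
move=> x y p q xr yr.
have dif h : h = f \/ h = g \/ h = fx \/ h = fy \/ h = gx \/ h = gy ->
    `|h x y - h 0 0| <= c / 4.
  move=> /hL[_ H]; apply: (@le_trans _ _ (L * r)); last nra.
  by apply: H; rewrite ?normr0 ?subr0// ?(le_trans xr)// (le_trans yr).
have low (d' m : R) : `|d'| <= c / 4 -> - (c / 4 * `|m|) <= d' * m.
  move=> hd; rewrite lerNl -mulNr (le_trans (ler_norm _))// normrM normrN.
  by rewrite ler_wpM2r.
have pq : `|p * q| <= (p ^+ 2 + q ^+ 2) / 2.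
  have h1 := sqr_ge0 (p - q); have h2 := sqr_ge0 (p + q).
  by rewrite ler_norml; apply/andP; split; lra.
have cpq := ler_wpM2l (ltW c0) pq.
have h1 := low _ (p ^+ 2) (dif fx ltac:(tauto)).
have h2 := low _ (p * q) (dif fy ltac:(tauto)).
have h3 := low _ (p * q) (dif gx ltac:(tauto)).
have h4 := low _ (q ^+ 2) (dif gy ltac:(tauto)).
have h5 := base p q.
rewrite !(ger0_norm (sqr_ge0 _)) in h1 h4.
rewrite /qform in h5 *.
lra.
Qed.

Definition planar (x y : R -> R) : Prop :=
  forall t, is_derive t 1 x (f (x t) (y t)) /\ is_derive t 1 y (g (x t) (y t)).

(** With [q = 0], a solution of the planar system becomes one of the
    four-dimensional system; this is how the two are compared. *)
Definition embed (x y : R -> R) (i : bool * bool) : R -> R :=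
  match i with
  | (false, false) => x
  | (false, true) => y
  | _ => cst 0
  end.

Lemma embed_ode {x y : R -> R} : planar x y -> ode star (embed x y).
Proof.
move=> pxy t [[] []] /=; rewrite ?mulr0 ?addr0 ?oppr0.
- exact: is_derive_cst.
- exact: is_derive_cst.
- by case: (pxy t).
- by case: (pxy t).
Qed.

Lemma energy_ge0 u t : 0 <= energy u t.
Proof. by rewrite addr_ge0 ?sqr_ge0. Qed.

Lemma energy_bound {u t} {e : R} : 0 < e -> energy u t < e ^+ 2 ->
  `|u ip t| < e /\ `|u iq t| < e.
Proof.
move=> e0 He; split; rewrite -(ltr_pXn2r (n := 2)) ?nnegrE ?(ltW e0)// real_normK ?num_real//;
  apply: le_lt_trans He; rewrite /energy ?lerDl ?lerDr sqr_ge0//.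
Qed.

Lemma energy_small {u t} {e : R} : 0 < e -> `|u ip t| < e / 2 -> `|u iq t| < e / 2 ->
  energy u t < e ^+ 2.
Proof.
move=> e0; rewrite !ltr_norml => /andP[h1 h2] /andP[h3 h4].
rewrite /energy !expr2; nra.
Qed.

Lemma energy_decay {u c r T} : ode star u ->
  (forall x y p q, `|x| <= r -> `|y| <= r -> c * (p ^+ 2 + q ^+ 2) <= qform x y p q) ->
  (forall t, 0 <= t <= T -> `|u ix t| <= r /\ `|u iy t| <= r) -> 0 <= T ->
  energy u T <= energy u 0 * expR (- (2 * c) * T).
Proof.
move=> ou hc ur T0; apply: (gronwall (energy_derive ou)) => // t tT.
have [xr yr] := ur t tT.
have := hc _ _ (u ip t) (u iq t) xr yr; rewrite -/(energy u t); lra.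
Qed.

Lemma planar_abs_bounded {x y : R -> R} T : planar x y ->
  exists M, forall i t, 0 <= t <= T -> `|embed x y i t| <= M.
Proof. by move=> pxy; exact: ode_bounded (embed_ode pxy). Qed.

Definition attracted (x y : R -> R) : Prop :=
  forall e : R, 0 < e -> exists T : R, forall t, T <= t -> `|x t| < e /\ `|y t| < e.

(** Compactness of the square makes the attraction of the planar system
    uniform, up to a small perturbation [q]; the time [T] may depend on the
    solution. *)
Lemma uniform_attraction {r e : R} : 0 < e ->
  (forall a b, `|a| <= r -> `|b| <= r -> exists x y : R -> R,
    [/\ planar x y, x 0 = a, y 0 = b & attracted x y]) ->
  exists2 eta : R, 0 < eta & forall u, ode star u ->
    `|u ix 0| <= r -> `|u iy 0| <= r -> `|u ip 0| < eta -> `|u iq 0| < eta ->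
    exists T, [/\ 1 <= T, `|u ix T| < e, `|u iy T| < e &
      exists x y : R -> R, [/\ planar x y, `|x 0| <= r, `|y 0| <= r &
        forall t, 0 <= t <= T -> `|x t - u ix t| < e /\ `|y t - u iy t| < e]].
Proof.
move=> e0 attr.
pose A : set (R * R) := `[- r, r] `*` `[- r, r].
have cA : compact A by apply: compact_setX; exact: segment_compact.
pose P (eta : R) (z : R * R) := forall u, ode star u ->
    u ix 0 = z.1 -> u iy 0 = z.2 -> `|u ip 0| < eta -> `|u iq 0| < eta ->
    exists T, [/\ 1 <= T, `|u ix T| < e, `|u iy T| < e &
      exists x y : R -> R, [/\ planar x y, `|x 0| <= r, `|y 0| <= r &
        forall t, 0 <= t <= T -> `|x t - u ix t| < e /\ `|y t - u iy t| < e]].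
have near_P z : A z -> \forall z' \near z & eta \near (0:R)^'+, P eta z'.
  case: z => a b [/=]; rewrite !in_itv/= -!ler_norml => ar br.
  have [x [y [pxy xa yb attr_xy]]] := attr a b ar br.
  have e20 : 0 < e / 2 by rewrite divr_gt0.
  have [T0 hT0] := attr_xy _ e20.
  pose T := Num.max 1 T0.
  have T1 : 1 <= T by rewrite le_max lexx.
  have T00 : T0 <= T by rewrite le_max lexx orbT.
  have Tpos : 0 <= T by rewrite (le_trans ler01).
  have [M hM] := planar_abs_bounded T pxy.
  have [d d0 hd] := continuous_dependence M T _ star_locally_lipschitz Tpos e20.
  exists (ball (a, b) d, [set eta | 0 < eta < d]) => /=.
    split; first exact: nbhsx_ballx.
    by near=> eta; apply/andP; split; near: eta;
      [exact: nbhs_right_gt|exact: nbhs_right_lt].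
  move=> [[a' b'] eta] /= [[/= a'a b'b] /andP[eta0 etad]] u ou ua ub up uq.
  have close := hd (embed x y) u (embed_ode pxy) ou hM.
  have {}close : forall i t, 0 <= t <= T -> `|embed x y i t - u i t| < e / 2.
    apply: close => -[[] []] /=.
    - by rewrite sub0r normrN (lt_trans uq).
    - by rewrite sub0r normrN (lt_trans up).
    - by rewrite yb ub.
    - by rewrite xa ua.
  have TT : 0 <= T <= T by rewrite Tpos lexx.
  have [xT yT] := hT0 T T00.
  exists T; split => //.
  - have h1 := close ix T TT; rewrite /= in h1.
    move: xT h1; rewrite !ltr_norml => /andP[? ?] /andP[? ?]; apply/andP; split; lra.
  - have h1 := close iy T TT; rewrite /= in h1.
    move: yT h1; rewrite !ltr_norml => /andP[? ?] /andP[? ?]; apply/andP; split; lra.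
  - exists x, y; split; rewrite ?xa ?yb// => t tT.
    have h1 := close ix t tT; have h2 := close iy t tT.
    by split; [apply: lt_trans h1 _|apply: lt_trans h2 _]; rewrite ltr_pdivrMr//; lra.
have := (compact_near_coveringP A).1 cA R (0:R)^'+ P _ near_P.
move=> /(_ _) nP.
have [eta [eta0 Peta]] : exists eta : R, 0 < eta /\ A `<=` P eta.
  near ((0:R)^'+) => eta; exists eta; split; first by near: eta; exact: nbhs_right_gt.
  by near: eta; exact: nP.
exists eta => // u ou ur1 ur2 up uq.
apply: (Peta (u ix 0, u iy 0)) => //; split; rewrite /= in_itv/= -ler_norml//.
Unshelve. all: by end_near. Qed.

Definition planar_stable : Prop :=
  forall e : R, 0 < e -> exists2 d : R, 0 < d & forall x y : R -> R, planar x y ->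
    `|x 0| < d -> `|y 0| < d -> forall t, 0 <= t -> `|x t| < e /\ `|y t| < e.

(** Each visit to the small square is followed, after time at least [1], by
    another one, the solution staying close to planar solutions in between;
    since the energy of [q] decreases meanwhile, this can be iterated. *)
Lemma star_stable {c r e : R} : 0 < c -> 0 < e -> e <= r ->
  (forall x y p q, `|x| <= r -> `|y| <= r -> c * (p ^+ 2 + q ^+ 2) <= qform x y p q) ->
  (forall a b, `|a| <= r -> `|b| <= r -> exists x y : R -> R,
    [/\ planar x y, x 0 = a, y 0 = b & attracted x y]) ->
  planar_stable ->
  exists d : R, [/\ 0 < d, d <= e & forall u, ode star u ->
    `|u ix 0| <= d -> `|u iy 0| <= d -> energy u 0 < d ^+ 2 ->
    forall t, 0 <= t -> `|u ix t| < e /\ `|u iy t| < e].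
Proof.
move=> c0 e0 er hc attr stab.
have e20 : 0 < e / 2 by rewrite divr_gt0.
have [d1 d10 hd1] := stab _ e20.
pose d2 := Num.min (d1 / 2) (e / 2).
have d20 : 0 < d2 by rewrite lt_min divr_gt0.
have d2d1 : d2 < d1 by rewrite (@le_lt_trans _ _ (d1 / 2)) ?ge_min ?lexx// ltr_pdivrMr//; lra.
have d2e : d2 <= e / 2 by rewrite ge_min lexx orbT.
have e2e : e / 2 < e by rewrite ltr_pdivrMr//; lra.
have attr2 a b : `|a| <= d2 -> `|b| <= d2 -> exists x y : R -> R,
    [/\ planar x y, x 0 = a, y 0 = b & attracted x y].
  have d2r : d2 <= r by rewrite (le_trans d2e)// (le_trans (ltW e2e)).
  by move=> ad bd; apply: attr; exact: le_trans d2r.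
have [eta eta0 step] := uniform_attraction d20 attr2.
have round u : ode star u -> `|u ix 0| <= d2 -> `|u iy 0| <= d2 ->
    energy u 0 < eta ^+ 2 -> exists T, [/\ 1 <= T,
      `|u ix T| <= d2, `|u iy T| <= d2, energy u T < eta ^+ 2 &
      forall t, 0 <= t <= T -> `|u ix t| < e /\ `|u iy t| < e].
  move=> ou xd yd Ed; have [p0 q0] := energy_bound eta0 Ed.
  have [T [T1 xT yT [x [y [pxy x0 y0 close]]]]] := step u ou xd yd p0 q0.
  have stay t : 0 <= t <= T -> `|u ix t| < e /\ `|u iy t| < e.
    move=> tT; have [h1 h2] := close t tT; have t0 : 0 <= t by case/andP: tT.
    have [h3 h4] := hd1 x y pxy (le_lt_trans x0 d2d1) (le_lt_trans y0 d2d1) t t0.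
    by move: h1 h2 h3 h4; rewrite !ltr_norml => /andP[? ?] /andP[? ?] /andP[? ?] /andP[? ?];
      split; apply/andP; split; lra.
  exists T; split => //; [exact: ltW|exact: ltW|].
  have Tpos : 0 <= T by rewrite (le_trans ler01).
  apply: le_lt_trans Ed.
  have stayr t : 0 <= t <= T -> `|u ix t| <= r /\ `|u iy t| <= r.
    by move=> /stay[h1 h2]; split; rewrite (le_trans (ltW _) er).
  apply: (le_trans (energy_decay ou hc stayr Tpos)).
  rewrite ler_piMr ?energy_ge0// -expR0 ler_expR mulNr oppr_le0.
  by rewrite !mulr_ge0// ltW.
exists (Num.min d2 eta); split; first by rewrite lt_min d20.
  by rewrite ge_min (le_trans d2e (ltW e2e)).
move=> u ou xd yd Ed t t0.
have m1 : Num.min d2 eta <= d2 by rewrite ge_min lexx.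
have m2 : Num.min d2 eta <= eta by rewrite ge_min lexx orbT.
have m0 : 0 < Num.min d2 eta by rewrite lt_min d20.
have iter n : exists T, [/\ n%:R <= T,
      `|u ix T| <= d2, `|u iy T| <= d2, energy u T < eta ^+ 2 &
      forall t, 0 <= t <= T -> `|u ix t| < e /\ `|u iy t| < e].
  elim: n => [|n [T [nT xT yT ET stay]]].
    exists 0; split => //; [exact: le_trans m1|exact: le_trans m1| |].
      by apply: (lt_le_trans Ed); rewrite ler_pXn2r ?nnegrE// ?ltW.
    move=> s /andP[s0 s0']; have -> : s = 0 by apply/eqP; rewrite eq_le s0 s0'.
    by split; rewrite (le_lt_trans _ e2e)// (le_trans _ d2e)// (le_trans _ m1).
  have := round _ (ode_shift T ou); rewrite /energy !add0r => /(_ xT yT ET).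
  move=> [T' [T'1 xT' yT' ET' stay']]; exists (T' + T); split => //.
    by rewrite -natr1 addrC lerD.
  move=> s /andP[s0 sT]; have [sT'|sT'] := leP s T; first by apply: stay; rewrite s0.
  have := stay' (s - T); rewrite subrK; apply.
  by rewrite subr_ge0 (ltW sT') lerBlDr.
have [T [nT _ _ _ stay]] := iter (Num.Def.truncn t).+1.
apply: stay; rewrite t0 (le_trans _ nT)// ltW//.
exact: truncnS_gt.
Qed.

(** The origin attracts a neighbourhood: [q] decays exponentially, and once it is
    small the planar dynamics brings [z] into ever smaller stable squares. *)
Lemma star_attracts {r : R} : 0 < r -> definite 0 0 ->
  (forall a b, `|a| <= r -> `|b| <= r -> exists x y : R -> R,
    [/\ planar x y, x 0 = a, y 0 = b & attracted x y]) ->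
  planar_stable ->
  exists2 d : R, 0 < d & forall u, ode star u -> (forall i, `|u i 0| <= d) ->
    forall e : R, 0 < e -> exists T : R, forall t i, T <= t -> `|u i t| < e.
Proof.
move=> r0 pd attr stab.
have [c [r1 [c0 r10 hc1]]] := definite_coercive pd.
pose r2 := Num.min r r1.
have r20 : 0 < r2 by rewrite lt_min r0.
have r2r : r2 <= r by rewrite ge_min lexx.
have r2r1 : r2 <= r1 by rewrite ge_min lexx orbT.
have hc x y p q : `|x| <= r2 -> `|y| <= r2 -> c * (p ^+ 2 + q ^+ 2) <= qform x y p q.
  by move=> xr yr; apply: hc1; exact: le_trans r2r1.
have attr2 a b : `|a| <= r2 -> `|b| <= r2 -> exists x y : R -> R,
    [/\ planar x y, x 0 = a, y 0 = b & attracted x y].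
  by move=> ar br; apply: attr; exact: le_trans r2r.
have [d [d0 dr hd]] := star_stable c0 r20 (lexx _) hc attr2 stab.
exists (d / 4); first by rewrite divr_gt0.
move=> u ou ud.
have d4d : d / 4 <= d by rewrite ler_pdivrMr//; lra.
have E0 : energy u 0 < d ^+ 2.
  by apply: energy_small => //; apply: (le_lt_trans (ud _)); rewrite ltr_pdivrMr//; lra.
have stay := hd u ou (le_trans (ud ix) d4d) (le_trans (ud iy) d4d) E0.
have stayr T t : 0 <= t <= T -> `|u ix t| <= r2 /\ `|u iy t| <= r2.
  by move=> /andP[/stay[h1 h2] _]; split; exact: ltW.
have decay t : 0 <= t -> energy u t <= energy u 0 * expR (- (2 * c) * t).
  by move=> t0; apply: (energy_decay ou hc (stayr t) t0).
have small eta : 0 < eta -> exists2 T, 0 <= T & forall t, T <= t -> energy u t < eta ^+ 2.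
  move=> eta0.
  pose T := d ^+ 2 / (2 * c * eta ^+ 2).
  have den : 0 < 2 * c * eta ^+ 2 by rewrite !mulr_gt0// exprn_gt0.
  exists T; first by rewrite divr_ge0 ?sqr_ge0// ltW.
  move=> t Tt; have t0 : 0 <= t by rewrite (le_trans _ Tt)// divr_ge0 ?sqr_ge0// ltW.
  apply: (le_lt_trans (decay t t0)).
  have h1 : d ^+ 2 <= t * (2 * c * eta ^+ 2) by rewrite -ler_pdivrMr.
  (* [T] is such that the linear minorant of the exponential is large enough *)
  have h2 : 1 + 2 * c * t <= expR (2 * c * t) by exact: expR_ge1Dx.
  rewrite mulNr expRN ltr_pdivrMr ?expR_gt0//.
  have e2 : 0 < eta ^+ 2 by rewrite exprn_gt0.
  have h3 := ler_wpM2l (ltW e2) h2.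
  lra.
move=> e e0.
pose e' := Num.min e r2.
have e'0 : 0 < e' by rewrite lt_min e0.
have e'e : e' <= e by rewrite ge_min lexx.
have e'r : e' <= r2 by rewrite ge_min lexx orbT.
have [d' [d'0 d'e hd']] := star_stable c0 e'0 e'r hc attr2 stab.
have [eta eta0 heta] := uniform_attraction d'0 attr2.
pose m := Num.min d' eta.
have m0 : 0 < m by rewrite lt_min d'0.
have md' : m <= d' by rewrite ge_min lexx.
have meta : m <= eta by rewrite ge_min lexx orbT.
have [T0 T00 hT0] := small m m0.
have [p0 q0] := energy_bound m0 (hT0 T0 (lexx _)).
have [x0 y0] := stay T0 T00.
have := heta _ (ode_shift T0 ou); rewrite !add0r.
move=> /(_ (ltW x0) (ltW y0) (lt_le_trans p0 meta) (lt_le_trans q0 meta)).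
move=> [T1 [T11 xT yT _]].
have T10 : 0 <= T1 by rewrite (le_trans ler01).
have T01 : T0 <= T1 + T0 by rewrite lerDr.
have := hd' _ (ode_shift (T1 + T0) ou); rewrite /energy !add0r.
move=> /(_ (ltW xT) (ltW yT)) fin.
have {}fin : forall t, 0 <= t -> `|u ix (t + (T1 + T0))| < e' /\ `|u iy (t + (T1 + T0))| < e'.
  apply: fin; apply: (lt_le_trans (hT0 _ T01)).
  by rewrite ler_pXn2r ?nnegrE// ltW.
exists (T1 + T0) => t i Tt.
have tT : 0 <= t - (T1 + T0) by rewrite subr_ge0.
have := fin _ tT; rewrite subrK => -[xe ye].
have [pe qe] := energy_bound m0 (hT0 t (le_trans T01 Tt)).
have me : m <= e by rewrite (le_trans md')// (le_trans d'e).
by case: i => [[] []]; [apply: lt_le_trans me|apply: lt_le_trans me|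
  apply: lt_le_trans e'e|apply: lt_le_trans e'e].
Qed.

(** * Orbits whose backward half stays in a bounded region of definiteness *)

Section Trapped.
Context (rho0 : 0 < rho).
Context (f00 : f 0 0 = 0) (g00 : g 0 0 = 0).
Context (C : R -> R -> Prop) (B : R).
Context (C_bounded : forall a b, C a b -> `|a| <= B /\ `|b| <= B).
Context (C_definite : forall a b, C a b -> definite a b).

Definition trapped u : Prop := forall t, t <= 0 -> C (u ix t) (u iy t).

Lemma definite_ge0 x y p q : definite x y -> 0 <= qform x y p q.
Proof.
move=> pd; case: (boolP ((p != 0) || (q != 0))) => [/pd/ltW//|].
rewrite negb_or !negbK => /andP[/eqP-> /eqP->].
by rewrite /qform expr0n/= !mulr0 !addr0.
Qed.

Lemma energy_nonincreasing {u s t} : ode star u -> trapped u ->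
  s <= t -> t <= 0 -> energy u t <= energy u s.
Proof.
move=> ou tu st t0; apply: (derive_le0_decreasing (energy_derive ou)) st => c /andP[_ ct].
rewrite mulNr oppr_le0 mulr_ge0//; apply/definite_ge0/C_definite/tu.
exact: le_trans ct t0.
Qed.

Definition discounted u t : R := expR (rho * t) * hamiltonian u t.

Lemma discounted_derive {u} : ode star u -> forall t,
  is_derive t 1 (discounted u) (- (expR (rho * t) * rho * (u ip t ^+ 2 / 2))).
Proof.
move=> ou t.
apply: (is_derive_eq (is_deriveM (is_derive_expRM _ _) (hamiltonian_derive ou t))).
by rewrite /GRing.scale/=; ring.
Qed.

Lemma discounted_nonincreasing {u s t} : ode star u -> s <= t ->
  discounted u t <= discounted u s.
Proof.
move=> ou st; apply: (derive_le0_decreasing (discounted_derive ou)) st => c _.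
rewrite oppr_le0 mulr_ge0 ?divr_ge0 ?sqr_ge0//.
by rewrite mulr_ge0 ?expR_ge0// ltW.
Qed.

(** A positive value of the Hamiltonian grows exponentially backwards in time,
    which is impossible while both [z] and [q] stay bounded. *)
Lemma hamiltonian_positive_unbounded {u t0} (N : R) : ode star u -> trapped u ->
  t0 <= 0 -> 0 < hamiltonian u t0 -> exists2 t : R, t <= 0 & N < energy u t.
Proof.
move=> ou tu t00 H0; apply: contrapT => nE.
have EN t : t <= 0 -> energy u t <= N.
  by move=> tle; rewrite leNgt; apply/negP => lt; apply: nE; exists t.
have N0 : 0 <= N := le_trans (energy_ge0 _ _) (EN 0 (lexx _)).
have [L L0 hL] := common_lipschitz B.
have grow t : t <= t0 -> hamiltonian u t0 * (1 + rho * (t0 - t)) <= hamiltonian u t.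
  move=> tt0.
  have : discounted u t0 <= discounted u t.
    exact: discounted_nonincreasing.
  rewrite /discounted => h.
  have -> : hamiltonian u t = expR (rho * t) * hamiltonian u t * expR (- (rho * t)).
    by rewrite mulrAC -expRD subrr expR0 mul1r.
  apply: (@le_trans _ _ (expR (rho * t0) * hamiltonian u t0 * expR (- (rho * t)))); last first.
    by rewrite ler_wpM2r// expR_ge0.
  rewrite [leRHS]mulrAC -expRD -mulrBr [leRHS]mulrC ler_wpM2l ?expR_ge1Dx//.
  exact: ltW.
pose K := (1 + N) * L * 2 + N / 2.
have K0 : 0 <= K by rewrite addr_ge0 ?divr_ge0// !mulr_ge0// addr_ge0.
have HK t : t <= 0 -> hamiltonian u t <= K.
  move=> tle; have [xB yB] := C_bounded _ _ (tu t tle).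
  have hf := (hL f ltac:(tauto)).1 _ _ xB yB.
  have hg := (hL g ltac:(tauto)).1 _ _ xB yB.
  have E := EN t tle; rewrite /energy in E.
  have p2 := sqr_ge0 (u ip t); have q2 := sqr_ge0 (u iq t).
  have bnd (a : R) : a ^+ 2 <= N -> `|a| <= 1 + N.
    move=> aN; have := sqr_ge0 (`|a| - 1); rewrite sqrrB real_normK ?num_real// => h.
    have := normr_ge0 a; lra.
  have hp : `|u ip t| <= 1 + N by apply: bnd; lra.
  have hq : `|u iq t| <= 1 + N by apply: bnd; lra.
  have h1 : u ip t * f (u ix t) (u iy t) <= (1 + N) * L.
    by apply: (le_trans (ler_norm _)); rewrite normrM ler_pM.
  have h2 : u iq t * g (u ix t) (u iy t) <= (1 + N) * L.
    by apply: (le_trans (ler_norm _)); rewrite normrM ler_pM.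
  rewrite /hamiltonian /K; lra.
pose t1 := t0 - K / hamiltonian u t0 / rho.
have dpos : 0 <= K / hamiltonian u t0 / rho by rewrite !divr_ge0// ltW.
have t1t0 : t1 <= t0 by rewrite gerBl.
have := grow t1 t1t0.
have -> : rho * (t0 - t1) = K / hamiltonian u t0.
  by rewrite /t1; field; rewrite !gt_eqF.
rewrite mulrDr mulr1 mulrC divfK ?gt_eqF// => h.
have := HK t1 (le_trans t1t0 t00); lra.
Qed.

(** If the Hamiltonian never becomes positive, its monotonicity forces [q1] to
    vanish identically, so [z] solves the unperturbed equation and stays at the
    equilibrium; there [q] grows exponentially backwards by definiteness. *)
Lemma hamiltonian_nonpositive_unbounded {u} (N : R) : ode star u -> trapped u ->
  u ix 0 = 0 -> u iy 0 = 0 -> 0 < energy u 0 ->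
  (forall t, t <= 0 -> hamiltonian u t <= 0) -> exists2 t : R, t <= 0 & N < energy u t.
Proof.
move=> ou tu x0 y0 E0 Hle.
have p0 t : t <= 0 -> u ip t = 0.
  have m0 s : s <= 0 -> discounted u s = 0.
    move=> s0; apply/eqP; rewrite eq_le mulr_ge0_le0 ?expR_ge0 ?Hle//=.
    apply: le_trans (discounted_nonincreasing ou s0).
    rewrite /discounted /hamiltonian x0 y0 f00 g00 !mulr0 !add0r.
    by rewrite expR0 mul1r divr_ge0 ?sqr_ge0.
  have sq a : 0 < a -> a * (u ip t ^+ 2 / 2) = 0 -> u ip t = 0.
    move=> a0 /eqP; rewrite mulf_eq0 gt_eqF//= mulf_eq0 invr_eq0 pnatr_eq0 orbF.
    by rewrite sqrf_eq0 => /eqP.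
  rewrite le_eqVlt => /orP[/eqP t0|t0].
    apply: (sq 1) => //; have := m0 0 (lexx _).
    rewrite /discounted /hamiltonian x0 y0 f00 g00 !mulr0 !add0r t0.
    by rewrite expR0 mul1r.
  have t1 : t - 1 < t by rewrite gtrBl.
  have d0 : is_derive t 1 (discounted u) 0.
    apply: (derive1_at_max (a := t - 1) (b := 0)).
    - exact: ltW (lt_trans t1 t0).
    - by move=> s _; have [] := discounted_derive ou s.
    - by rewrite in_itv/= t1.
    - by move=> s; rewrite in_itv/= => /andP[_ s0]; rewrite !m0// ltW.
  have := @derive_val _ _ _ _ _ _ _ d0; rewrite (@derive_val _ _ _ _ _ _ _ (discounted_derive ou t)).
  move=> /eqP; rewrite oppr_eq0 => /eqP; apply: sq.
  by rewrite mulr_gt0// expR_gt0.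
have [L L0 hL] := common_lipschitz B.
pose v i t := u i (- t).
have ov := ode_reverse ou.
have z0 t : t <= 0 -> u ix t = 0 /\ u iy t = 0.
  move=> tle.
  have dh s : is_derive s 1 (fun s => u ix (- s) ^+ 2 + u iy (- s) ^+ 2)
    (- (2 * u ix (- s) * (f (u ix (- s)) (u iy (- s)) + u ip (- s)) + 2 * u iy (- s) * g (u ix (- s)) (u iy (- s)))).
    have H := is_deriveD (is_deriveX 2 (ov s ix)) (is_deriveX 2 (ov s iy)).
    apply: (is_derive_eq H).
    by rewrite /GRing.scale/= !expr1; ring.
  have := gronwall (K := 4 * L) (T := - t) dh.
  rewrite oppr0 x0 y0 expr0n/= addr0 mul0r opprK oppr_ge0 => gr.
  have {gr}h : u ix t ^+ 2 + u iy t ^+ 2 <= 0.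
    apply: gr => // s /andP[s0 st].
    have sle : - s <= 0 by rewrite oppr_le0.
    rewrite p0// addr0.
    have [xB yB] := C_bounded _ _ (tu _ sle).
    have B0 : 0 <= B := le_trans (normr_ge0 _) xB.
    set x := u ix (- s) in xB *; set y := u iy (- s) in yB *.
    have bnd h : h = f \/ h = g -> h 0 0 = 0 -> `|h x y| <= L * (`|x| + `|y|).
      move=> hh h0; rewrite -[h x y]subr0 -h0.
      by apply: (hL h ltac:(tauto)).2; rewrite ?normr0 ?subr0 ?lerDl ?lerDr.
    have hf := bnd f ltac:(tauto) f00; have hg := bnd g ltac:(tauto) g00.
    have h1 : - (x * f x y) <= `|x| * (L * (`|x| + `|y|)).
      by apply: (le_trans (ler_norm _)); rewrite normrN normrM ler_wpM2l.
    have h2 : - (y * g x y) <= `|y| * (L * (`|x| + `|y|)).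
      by apply: (le_trans (ler_norm _)); rewrite normrN normrM ler_wpM2l.
    have h3 : L * (`|x| + `|y|) ^+ 2 <= L * (2 * (x ^+ 2 + y ^+ 2)).
      apply: ler_wpM2l => //; have := sqr_ge0 (`|x| - `|y|).
      by rewrite -(real_normK (num_real x)) -(real_normK (num_real y)); lra.
    lra.
  have hx := sqr_ge0 (u ix t); have hy := sqr_ge0 (u iy t).
  by split; apply/eqP; rewrite -sqrf_eq0 eq_le sqr_ge0 andbT; lra.
have C00 : C 0 0 by have := tu 0 (lexx _); rewrite x0 y0.
have [c [r [c0 r0 hc]]] := definite_coercive (C_definite _ _ C00).
pose T := N / (2 * c * energy u 0).
have den : 0 < 2 * c * energy u 0 by rewrite !mulr_gt0.
exists (- `|T|); first by rewrite oppr_le0.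
have nT : - `|T| <= 0 by rewrite oppr_le0.
have [d [d1 d2 dE]] := mean_value (energy_derive ou) nT.
have [dx dy] := z0 d d2.
have h1 : c * energy u d <= qform 0 0 (u ip d) (u iq d) by apply: hc; rewrite normr0 ltW.
have h2 := energy_nonincreasing ou tu d2 (lexx _).
have h3 : N <= `|T| * (2 * c * energy u 0) by rewrite -ler_pdivrMr// ler_norm.
rewrite dx dy sub0r opprK in dE.
have h4 : `|T| * (2 * (c * energy u 0)) <= `|T| * (2 * qform 0 0 (u ip d) (u iq d)).
  apply: ler_wpM2l => //; have := ler_wpM2l (ltW c0) h2; lra.
lra.
Qed.

Lemma energy_unbounded {u} (N : R) : ode star u -> trapped u ->
  u ix 0 = 0 -> u iy 0 = 0 -> 0 < energy u 0 ->
  exists2 t : R, t <= 0 & N < energy u t.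
Proof.
move=> ou tu x0 y0 E0.
have [[t [t0 Ht]]|nH] := pselect (exists t, t <= 0 /\ 0 < hamiltonian u t).
  exact: hamiltonian_positive_unbounded Ht.
apply: hamiltonian_nonpositive_unbounded => // t t0.
by rewrite leNgt; apply/negP => Ht; apply: nH; exists t.
Qed.

(** The rate of change of [q] is at most proportional to [|q|], which is
    largest at the beginning of a time interval. *)
Lemma adjoint_variation : exists2 K : R, 0 < K & forall u s t m, ode star u -> trapped u ->
  s <= t -> t <= 0 -> 0 <= m -> energy u s <= m ^+ 2 ->
  `|u ip t - u ip s| <= K * m * (t - s) /\ `|u iq t - u iq s| <= K * m * (t - s).
Proof.
have [L L0 hL] := common_lipschitz B.
have rho1 : 0 <= rho := ltW rho0.
exists (rho + 2 * L + 1); first by rewrite ltr_wpDl// addr_ge0// mulr_ge0.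
move=> u s t m ou tu st t0 m0 Em.
have ts : 0 <= t - s by rewrite subr_ge0.
have bnd c : s <= c -> c <= t -> `|u ip c| <= m /\ `|u iq c| <= m.
  move=> sc ct; have c0 := le_trans ct t0.
  have Ec := le_trans (energy_nonincreasing ou tu sc c0) Em; rewrite /energy in Ec.
  have p2 := sqr_ge0 (u ip c); have q2 := sqr_ge0 (u iq c).
  by split; rewrite -(ler_pXn2r (n := 2)) ?nnegrE// real_normK ?num_real//; lra.
have part h i c : h = fx \/ h = fy \/ h = gx \/ h = gy -> i = ip \/ i = iq ->
    s <= c -> c <= t -> `|h (u ix c) (u iy c) * u i c| <= L * m.
  move=> hh ii sc ct; have [xB yB] := C_bounded _ _ (tu c (le_trans ct t0)).
  have [pm qm] := bnd c sc ct.
  rewrite normrM ler_pM//; first by apply: (hL h ltac:(tauto)).1.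
  by case: ii => ->.
have rpart i c : i = ip \/ i = iq -> s <= c -> c <= t -> `|rho * u i c| <= rho * m.
  move=> ii sc ct; have [pm qm] := bnd c sc ct.
  by rewrite normrM (ger0_norm rho1) ler_wpM2l//; case: ii => ->.
split.
- have [c [sc ct ->]] := mean_value (fun t => ou t ip) st.
  rewrite normrM (ger0_norm ts) ler_wpM2r//=.
  have h1 := part fx ip c ltac:(tauto) ltac:(tauto) sc ct.
  have h2 := part gx iq c ltac:(tauto) ltac:(tauto) sc ct.
  have h3 := rpart ip c ltac:(tauto) sc ct.
  move: h1 h2 h3; rewrite !ler_norml => /andP[? ?] /andP[? ?] /andP[? ?].
  by apply/andP; split; lra.
- have [c [sc ct ->]] := mean_value (fun t => ou t iq) st.
  rewrite normrM (ger0_norm ts) ler_wpM2r//=.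
  have h1 := part fy ip c ltac:(tauto) ltac:(tauto) sc ct.
  have h2 := part gy iq c ltac:(tauto) ltac:(tauto) sc ct.
  have h3 := rpart iq c ltac:(tauto) sc ct.
  move: h1 h2 h3; rewrite !ler_norml => /andP[? ?] /andP[? ?] /andP[? ?].
  by apply/andP; split; lra.
Qed.

(** Over a short enough time step, [q] turns by less than a right angle. And a
    large [q] cannot be horizontal at the beginning of the step: [q1] would
    stay large during the step and push [x] out of the bounded region. *)
Lemma trapped_step : exists h N : R, 0 < h /\ forall u t, ode star u -> trapped u ->
  t <= 0 ->
  (0 < energy u (t - h) -> 0 < u ip t * u ip (t - h) + u iq t * u iq (t - h)) /\
  (N < energy u (t - h) -> u iq (t - h) != 0).
Proof.
have [K K0 hK] := adjoint_variation.
have [L L0 hL] := common_lipschitz B.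
(* during the step [q] varies by at most a quarter of its initial norm *)
pose h := (4 * K)^-1.
have h0 : 0 < h by rewrite invr_gt0 mulr_gt0.
(* above this energy a horizontal [q] gives [x] a speed that makes it travel
   more than the diameter [2 * B] of the region *)
pose N := (4 * ((2 * `|B| + 1) / h + L)) ^+ 2.
exists h, N; split => // u t ou tu t0.
have th : t - h <= t by rewrite gerBl ltW.
pose m := Num.sqrt (energy u (t - h)).
have m0 : 0 <= m by rewrite sqrtr_ge0.
have mE : m ^+ 2 = energy u (t - h) by rewrite sqr_sqrtr// energy_ge0.
have var c : t - h <= c -> c <= t ->
    `|u ip c - u ip (t - h)| <= m / 4 /\ `|u iq c - u iq (t - h)| <= m / 4.
  move=> hc ct.
  have Em : energy u (t - h) <= m ^+ 2 by rewrite mE.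
  have [h1 h2] := hK u (t - h) c m ou tu hc (le_trans ct t0) m0 Em.
  have h3 : K * m * (c - (t - h)) <= m / 4.
    have -> : m / 4 = K * m * h by rewrite /h; field; rewrite gt_eqF.
    by apply: ler_wpM2l; [rewrite mulr_ge0// ltW|lra].
  by split; exact: le_trans h3.
have pm : `|u ip (t - h)| <= m.
  by rewrite -(ler_pXn2r (n := 2)) ?nnegrE// real_normK ?num_real// mE lerDl sqr_ge0.
have qm : `|u iq (t - h)| <= m.
  by rewrite -(ler_pXn2r (n := 2)) ?nnegrE// real_normK ?num_real// mE lerDr sqr_ge0.
split=> [E0|EN].
  have mpos : 0 < m by rewrite sqrtr_gt0.
  have [h1 h2] := var t th (lexx _).
  have k1 : - (m / 4 * m) <= (u ip t - u ip (t - h)) * u ip (t - h).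
    by rewrite lerNl -mulNr (le_trans (ler_norm _))// normrM normrN ler_pM.
  have k2 : - (m / 4 * m) <= (u iq t - u iq (t - h)) * u iq (t - h).
    by rewrite lerNl -mulNr (le_trans (ler_norm _))// normrM normrN ler_pM.
  have k3 : m ^+ 2 = u ip (t - h) ^+ 2 + u iq (t - h) ^+ 2 := mE.
  have k4 : 0 < m ^+ 2 by rewrite exprn_gt0.
  lra.
apply/negP => /eqP q0.
have pE : `|u ip (t - h)| = m.
  by rewrite /m /energy q0 expr0n/= addr0 sqrtr_sqr.
have big : 4 * ((2 * `|B| + 1) / h + L) < m.
  rewrite -(ltr_pXn2r (n := 2)) ?nnegrE ?mE//.
  by rewrite mulr_ge0// addr_ge0// divr_ge0 ?(ltW h0)// addr_ge0// mulr_ge0.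
have [c [hc ct e]] := mean_value (fun t => ou t ix) th.
have [v1 _] := var c hc ct.
have [xB yB] := C_bounded _ _ (tu c (le_trans ct t0)).
have fL := (hL f ltac:(tauto)).1 _ _ xB yB.
have [x1 _] := C_bounded _ _ (tu t t0).
have [x2 _] := C_bounded _ _ (tu (t - h) (le_trans th t0)).
have pbig : m * (3 / 4) <= `|u ip c|.
  have : `|u ip (t - h)| <= `|u ip c| + `|u ip c - u ip (t - h)|.
    have {1}-> : u ip (t - h) = u ip c - (u ip c - u ip (t - h)) by ring.
    exact: ler_normB.
  rewrite pE; lra.
have vbig : (2 * `|B| + 1) / h <= `|f (u ix c) (u iy c) + u ip c|.
  have : `|u ip c| <= `|f (u ix c) (u iy c) + u ip c| + `|f (u ix c) (u iy c)|.
    have {1}-> : u ip c = (f (u ix c) (u iy c) + u ip c) - f (u ix c) (u iy c) by ring.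
    exact: ler_normB.
  have : 0 <= (2 * `|B| + 1) / h by rewrite divr_ge0 ?(ltW h0)// addr_ge0// mulr_ge0.
  lra.
have : 2 * `|B| + 1 <= `|u ix t - u ix (t - h)|.
  rewrite e /= normrM (_ : t - (t - h) = h); last by ring.
  by rewrite (gtr0_norm h0) -ler_pdivrMr.
have := ler_normB (u ix t) (u ix (t - h)); have := ler_norm B; lra.
Qed.

Lemma backward_continuous {U : R -> bool * bool -> R -> R} (t : R) :
  (forall a, ode star (U a)) -> (forall i, continuous (fun a => U a i 0)) ->
  t <= 0 -> forall i, continuous (fun a => U a i t).
Proof.
move=> oU cU t0 i a; apply/cvgrPdist_lt => e e0.
have oV b := ode_reverse (oU b).
have [M hM] := ode_bounded (- t) (oV a).
have t0' : 0 <= - t by rewrite oppr_ge0.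
have [d d0 hd] := continuous_dependence M _ _
  (locally_lipschitz_opp star_locally_lipschitz) t0' e0.
have nb : \forall b \near a, forall j, `|U a j 0 - U b j 0| < d.
  by apply: (@filter_forall _ _ _ _ (nbhs_filter a)) => j; exact: ((cvgrPdist_lt _ _).1 (cU j a) d d0).
near=> b.
have := hd _ _ (oV a) (oV b) hM; rewrite oppr0 => /(_ _ i (- t)).
rewrite opprK; apply; last by rewrite t0' lexx.
by near: b.
Unshelve. all: by end_near. Qed.

(** The angle of [q] along the loop of initial conditions makes one turn at
    time [0], hence at all multiples of the step in the past, as [q] never
    vanishes and turns by less than a right angle at each step. But far in the past [q] is large on the
    whole loop, hence never horizontal. *)
Lemma loop_not_trapped (e : R) (U : R -> bool * bool -> R -> R) : 0 < e ->
  (forall a, ode star (U a)) ->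
  (forall a, [/\ U a ix 0 = 0, U a iy 0 = 0, U a ip 0 = e * cos a & U a iq 0 = e * sin a]) ->
  ~ (forall a, trapped (U a)).
Proof.
move=> e0 oU U0 tU.
have Uc (t : R) i : t <= 0 -> continuous (fun a => U a i t).
  move=> t0; apply: (backward_continuous t oU _ t0) => {i}i.
  have : (fun a => U a i 0) = match i with
    | (false, false) | (false, true) => cst 0
    | (true, false) => fun a => e * cos a | (true, true) => fun a => e * sin a end.
    by apply/funext => a; have [] := U0 a; case: i => [[] []].
  move=> ->; case: i => [[] []] a.
  - by apply: cvgM; [exact: cvg_cst|exact: continuous_sin].
  - by apply: cvgM; [exact: cvg_cst|exact: continuous_cos].
  - exact: cvg_cst.
  - exact: cvg_cst.
have Uper (t : R) i : t <= 0 -> U (pi *+ 2) i t = U 0 i t.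
  move=> t0; have t0' : 0 <= - t by rewrite oppr_ge0.
  have := ode_unique (locally_lipschitz_opp star_locally_lipschitz)
    (ode_reverse (oU (pi *+ 2))) (ode_reverse (oU 0)) _ (- t) i t0'.
  rewrite opprK; apply=> j; rewrite oppr0.
  have [x2 y2 p2 q2] := U0 (pi *+ 2); have [x1 y1 p1 q1] := U0 0.
  by case: j => [[] []]; rewrite ?(x1, x2, y1, y2, p1, p2, q1, q2)// ?cos2pi ?cos0 ?sin2pi ?sin0.
have E0 a : 0 < energy (U a) 0.
  have [_ _ p q] := U0 a; rewrite /energy p q !exprMn -mulrDr cos2sin2 subrK mulr1.
  by rewrite exprn_gt0.
have Epos a t : t <= 0 -> 0 < energy (U a) t.
  by move=> t0; apply: lt_le_trans (E0 a) (energy_nonincreasing (oU a) (tU a) t0 (lexx _)).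
have [h [N [h0 step]]] := trapped_step.
have winds k : winds_once (fun a => U a ip (- (k%:R * h))) (fun a => U a iq (- (k%:R * h))).
  elim: k => [|k IH].
    rewrite mul0r oppr0.
    have -> : (fun a => U a ip 0) = (fun a => e * cos a).
      by apply/funext => a; have [] := U0 a.
    have -> : (fun a => U a iq 0) = (fun a => e * sin a).
      by apply/funext => a; have [] := U0 a.
    exact: circle_winds_once.
  have neg j : - (j%:R * h) <= 0 by rewrite oppr_le0 mulr_ge0// ltW.
  apply: (winds_once_acute _ _ _ _ _ _ _ _ _ IH); rewrite ?Uper//; try exact: Uc.
  move=> a; have [] := step (U a) _ (oU a) (tU a) (neg k).
  have -> : - (k%:R * h) - h = - (k.+1%:R * h) by rewrite -natr1; ring.
  by move=> acute _; apply/acute/Epos.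
have cI : compact `[0 : R, pi *+ 2] by exact: segment_compact.
have far : \forall s \near +oo, `[0 : R, pi *+ 2] `<=` (fun a => 0 <= s -> N < energy (U a) (- s)).
  apply: ((compact_near_coveringP _).1 cI R +oo
    (fun s a => 0 <= s -> N < energy (U a) (- s))) => a _.
  have [x0 y0 _ _] := U0 a.
  have [t t0 Et] := energy_unbounded N (oU a) (tU a) x0 y0 (E0 a).
  have Ec : continuous (fun b => energy (U b) t).
    by move=> b; apply: cvgD; [apply: cvgM|apply: cvgM]; exact: Uc.
  exists ([set b | N < energy (U b) t], [set s | - t < s]) => /=.
    split; last by exists (- t); split; [exact: num_real|].

    exact: (cvgr_gt _ (Ec a) _ Et).
  move=> [b s] /= [Eb ts] s0; apply: (lt_le_trans Eb).
  by apply: energy_nonincreasing => //; rewrite lerNl ltW.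
have [n hn] : exists n : nat, `[0 : R, pi *+ 2] `<=`
    (fun a => 0 <= n.+1%:R * h -> N < energy (U a) (- (n.+1%:R * h))).
  have [M [_ hM]] := far.
  exists (Num.Def.truncn (M / h)); apply: hM.
  rewrite -ltr_pdivrMr//; exact: truncnS_gt.
have nh : - (n%:R * h) <= 0 by rewrite oppr_le0 mulr_ge0// ltW.
have n1h : 0 <= n.+1%:R * h by rewrite mulr_ge0// ltW.
have n1h' : - (n.+1%:R * h) <= 0 by rewrite oppr_le0.
have [a a2 qa] := winds_once_meets_axis (Uc _ iq n1h') (winds n.+1).
have [_] := step (U a) _ (oU a) (tU a) nh.
have -> : - (n%:R * h) - h = - (n.+1%:R * h) by rewrite -natr1; ring.
rewrite qa eqxx => absurd; suff : false by [].
by apply: absurd; apply: hn => //=; rewrite in_itv.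
Qed.

End Trapped.

End StarSystem.

(** * From column vectors to coordinates *)

Section Coordinates.
Context {R : realType}.
Local Notation plane := 'cV[R]_2.
Implicit Types (z : plane) (w : plane * plane) (s t : R).

Definition vec (a b : R) : plane := \col_i (if i == 0 then a else b).

Lemma I2P (i : 'I_2) : i = 0 \/ i = 1.
Proof. by case: i => [[|[|//]] h]; [left|right]; exact: val_inj. Qed.

Lemma vec0 a b : vec a b 0 0 = a. Proof. by rewrite mxE. Qed.
Lemma vec1 a b : vec a b 1 0 = b. Proof. by rewrite mxE. Qed.

Lemma vec_eta z : vec (z 0 0) (z 1 0) = z.
Proof.
by apply/colP => i; have [->|->] := I2P i; rewrite mxE.
Qed.

Lemma vec_combination a b : vec a b = a *: basis_vec 0 + b *: basis_vec 1.
Proof.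
by apply/colP => i; have [->|->] := I2P i; rewrite !mxE/= ?mulr1 ?mulr0 ?addr0 ?add0r.
Qed.

Lemma vec_shift0 h a b : vec (h + a) b = h *: basis_vec 0 + vec a b.
Proof. by rewrite !vec_combination scalerDl addrA. Qed.

Lemma vec_shift1 h a b : vec a (h + b) = h *: basis_vec 1 + vec a b.
Proof. by rewrite !vec_combination scalerDl addrCA. Qed.

Lemma vec00 : vec 0 0 = 0.
Proof. by rewrite vec_combination !scale0r addr0. Qed.

Lemma continuous_vec : continuous (fun u : R * R => vec u.1 u.2).
Proof.
have -> : (fun u : R * R => vec u.1 u.2) =
    (fun u => u.1 *: basis_vec 0 + u.2 *: basis_vec 1).
  by apply/funext => u; rewrite vec_combination.
by move=> u; apply: cvgD; apply: cvgZr_tmp; [exact: cvg_fst|exact: cvg_snd].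
Qed.

Lemma plane_norm_lt z e : 0 < e -> (`|z| < e) = (`|z 0 0| < e) && (`|z 1 0| < e).
Proof.
move=> e0; rewrite /Num.Def.normr/= mx_normrE; apply/idP/andP => [h|[h0 h1]].
  by split; apply: le_lt_trans h; [exact: (le_bigmax _ _ (0, 0))|exact: (le_bigmax _ _ (1, 0))].
apply: bigmax_lt => // -[i j] _ /=; rewrite (ord1 j).
by have [->|->] := I2P i.
Qed.

Definition state_coord w (i : bool * bool) : R :=
  (if i.1 then w.2 else w.1) (if i.2 then 1 else 0) 0.

Lemma coord_small w e : 0 < e -> (forall i, `|state_coord w i| < e) -> `|w| < e.
Proof.
move=> e0 h; rewrite prod_normE gt_max !plane_norm_lt//.
by rewrite (h ix) (h iy) (h ip) (h iq).
Qed.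

Lemma is_derive_continuous_linear {V W : normedModType R} {L : V -> W} {u : R -> V} {t du} :
  linear L -> continuous L -> is_derive t 1 u du ->
  is_derive t 1 (L \o u) (L du).
Proof.
move=> lL cL [du1 du2].
have L0 : L 0 = 0.
  by have := lL (-1) 0 0; rewrite scaler0 addr0 scaleN1r addNr.
have LB a b : L (a - b) = L a - L b.
  by rewrite -scaleN1r addrC lL scaleN1r addrC.
have LZ k a : L (k *: a) = k *: L a.
  by rewrite -[k *: a]addr0 lL L0 addr0.
have E : (fun h : R => h^-1 *: ((L \o u) (h *: 1 + t) - (L \o u) t)) =
    L \o (fun h => h^-1 *: (u (h *: 1 + t) - u t)).
  by apply/funext => h /=; rewrite LZ LB.
have c : (L \o (fun h => h^-1 *: (u (h *: 1 + t) - u t))) h @[h --> 0^'] --> L du.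
  have q : (fun h : R => h^-1 *: (u (h *: 1 + t) - u t)) @ 0^' --> du.
    by rewrite -du2; exact: du1.
  exact: (cvg_comp _ _ q (cL du)).
split.
  by rewrite /derivable E; apply/cvg_ex; exists (L du).
by rewrite /derive E; exact/cvg_lim.
Qed.

Lemma is_derive_coord {u : R -> plane * plane} {t du} i : is_derive t 1 u du ->
  is_derive t 1 (fun s => state_coord (u s) i) (state_coord du i).
Proof.
apply: (is_derive_continuous_linear (L := state_coord ^~ i)).
  by move=> k x y; case: i => [[] []]; rewrite /state_coord/= !mxE.
move=> w; rewrite /state_coord; case: i => [[] j] /=.
  exact: (@continuous_comp _ _ _ snd (fun z : plane => z _ 0) _ cvg_snd (@coord_continuous _ _ _ _ _ _)).
exact: (@continuous_comp _ _ _ fst (fun z : plane => z _ 0) _ cvg_fst (@coord_continuous _ _ _ _ _ _)).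
Qed.

Lemma is_derive_entry {u : R -> plane} {t du} i : is_derive t 1 u du ->
  is_derive t 1 (fun s => u s i 0) (du i 0).
Proof.
apply: (is_derive_continuous_linear (L := fun z : plane => z i 0)).
  by move=> k x y; rewrite !mxE.
exact: coord_continuous.
Qed.

Lemma is_derive_vec {x y : R -> R} {t dx dy} :
  is_derive t 1 x dx -> is_derive t 1 y dy ->
  is_derive t 1 (fun s => vec (x s) (y s)) (vec dx dy).
Proof.
move=> [x1 x2] [y1 y2].
have D : derivable (fun s => vec (x s) (y s)) t 1.
  apply/derivable_mxP => i j; rewrite (ord1 j).
  have [->|->] := I2P i.
    by under eq_fun do rewrite vec0.
  by under eq_fun do rewrite vec1.
split => //; rewrite derive_mx//; apply/colP => i; rewrite !mxE.
have [->|->] := I2P i => /=.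
  by rewrite -x2; congr (derive _ _ _); apply/funext => s; rewrite mxE.
by rewrite -y2; congr (derive _ _ _); apply/funext => s; rewrite mxE.
Qed.

Lemma Ck1_C1 {h : plane -> R} : Ck 1 h ->
  C1 (fun a b => h (vec a b)) (fun a b => 'D_(basis_vec 0) h (vec a b))
     (fun a b => 'D_(basis_vec 1) h (vec a b)).
Proof.
move=> [_ dh]; have [d0 c0] := dh 0; have [d1 c1] := dh 1; split.
- move=> a b; have E : (fun k : R => k^-1 *: (h (vec (k *: 1 + a) b) - h (vec a b))) =
    (fun k => k^-1 *: (h (k *: basis_vec 0 + vec a b) - h (vec a b))).
    by apply/funext => k; rewrite -vec_shift0 [k *: 1]mulr1.
  by split; rewrite /derivable /derive/= E//; exact: d0.
- move=> a b; have E : (fun k : R => k^-1 *: (h (vec a (k *: 1 + b)) - h (vec a b))) =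
    (fun k => k^-1 *: (h (k *: basis_vec 1 + vec a b) - h (vec a b))).
    by apply/funext => k; rewrite -vec_shift1 [k *: 1]mulr1.
  by split; rewrite /derivable /derive/= E//; exact: d1.
- by move=> u; exact: (@continuous_comp _ _ _ (fun u : R * R => vec u.1 u.2)
    (fun z => 'D_(basis_vec 0) h z) u (continuous_vec u) (c0 _)).
- by move=> u; exact: (@continuous_comp _ _ _ (fun u : R * R => vec u.1 u.2)
    (fun z => 'D_(basis_vec 1) h z) u (continuous_vec u) (c1 _)).
Qed.

End Coordinates.

Section Bridge.
Context {R : realType} (F : 'cV[R]_2 -> 'cV[R]_2) (rho : R).
Local Notation plane := 'cV[R]_2.

Definition component (i : 'I_2) (a b : R) : R := F (vec a b) i 0.
Definition partial (i j : 'I_2) (a b : R) : R := DF F (vec a b) i j.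

Lemma smooth_C1 : smooth F ->
  forall i, C1 (component i) (partial i 0) (partial i 1).
Proof.
move=> sF i; have := Ck1_C1 (sF 1%N i).
by congr C1; apply/funext => a; apply/funext => b; rewrite /partial mxE.
Qed.

Lemma smooth_lipschitz : smooth F -> forall i j, locally_lipschitz2 (partial i j).
Proof.
move=> sF i j; have [_ /(_ j)[_ H]] := sF 2%N i.
have := C1_lipschitz (Ck1_C1 H); congr locally_lipschitz2.
by apply/funext => a; apply/funext => b; rewrite /partial mxE.
Qed.

Definition star_coord := @star R (component 0) (component 1)
  (partial 0 0) (partial 0 1) (partial 1 0) (partial 1 1) rho.

Definition planar_coord := @planar R (component 0) (component 1).

Definition definite_coord :=
  @definite R (partial 0 0) (partial 0 1) (partial 1 0) (partial 1 1) rho.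

Lemma star_fieldE w i : state_coord (star_field F rho w) i = star_coord (state_coord w) i.
Proof.
have l1 : lift ord0 ord0 = 1 :> 'I_2 by exact: val_inj.
case: i => [[] []]; rewrite /star_coord /state_coord/= /component /partial ?vec_eta !mxE ?big_ord_recl ?big_ord0 ?l1 ?mxE/=.
- ring.
- ring.
- ring.
- ring.
Qed.

Lemma solution_ode {w : R -> plane * plane} : solution (star_field F rho) w ->
  ode star_coord (fun i t => state_coord (w t) i).
Proof. by move=> sw t i; rewrite -star_fieldE; exact: is_derive_coord (sw t). Qed.

Lemma solution_planar {z : R -> plane} : solution F z ->
  planar_coord (fun t => z t 0 0) (fun t => z t 1 0).
Proof.
by move=> sz t; rewrite /component vec_eta; split; exact: is_derive_entry (sz t).
Qed.

Lemma planar_solution {x y : R -> R} : planar_coord x y ->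
  solution F (fun t => vec (x t) (y t)).
Proof.
move=> pxy t; have [dx dy] := pxy t.
by rewrite -[F _]vec_eta; exact: is_derive_vec.
Qed.

Lemma D_set_definite x y : D_set F rho (vec x y) -> definite_coord x y.
Proof.
move=> D p q pq0.
have v0 : vec p q != 0.
  by apply: contraTneq pq0 => /colP e; have := e 0; have := e 1; rewrite !mxE/= => -> ->; rewrite eqxx.
have := D _ v0.
have l1 : lift ord0 ord0 = 1 :> 'I_2 by exact: val_inj.
rewrite !mxE !big_ord_recl !big_ord0 l1 !mxE !big_ord_recl !big_ord0 l1 !mxE/= => h.
rewrite /qform /partial !mxE.
move: h; rewrite ?eqxx/= ?mulr0n ?mulr1n; lra.
Qed.

End Bridge.

(** * Asymptotic stability and the component enclosed by the cycle *)

Section Main.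
Context {R : realType} (F : 'cV[R]_2 -> 'cV[R]_2) (rho : R).
Local Notation plane := 'cV[R]_2.

Lemma asymptotically_stable_planar :
  asymptotically_stable F [set 0] ->
  @planar_stable R (component F 0) (component F 1) /\
  exists2 r : R, 0 < r & forall a b, `|a| <= r -> `|b| <= r -> exists x y : R -> R,
    [/\ planar_coord F x y, x 0 = a, y 0 = b & attracted x y].
Proof.
move=> [stab [A [opA A0 Ab]]]; split.
  move=> e e0.
  have sub : [set 0] `<=` ball (0 : plane) e by move=> _ ->; exact: ballxx.
  have [V [opV V0 hV]] := stab _ (ball_open _ _) sub.
  have /nbhs_ballP[d /= d0 hd] : nbhs (0 : plane) V.
    by apply: open_nbhs_nbhs; split => //; exact: V0.
  exists d => // x y pxy x0 y0 t t0.
  have sz := planar_solution F pxy.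
  have /(hV _ sz)/(_ t t0) : V (vec (x 0) (y 0)).
    by apply: hd; rewrite -ball_normE/= sub0r normrN plane_norm_lt// vec0 vec1 x0.
  by rewrite -ball_normE/= sub0r normrN plane_norm_lt// vec0 vec1 => /andP[].
have /nbhs_ballP[d /= d0 hd] : nbhs (0 : plane) A.
  by apply: open_nbhs_nbhs; split => //; exact: A0.
exists (d / 2); first by rewrite divr_gt0.
move=> a b ar br.
have d2 : d / 2 < d by rewrite ltr_pdivrMr//; lra.
have [u [su u0 tu]] : basin F [set 0] (vec a b).
  apply/Ab/hd; rewrite -ball_normE/= sub0r normrN plane_norm_lt// vec0 vec1.
  by rewrite !(le_lt_trans _ d2).
exists (fun t => u t 0 0), (fun t => u t 1 0); split.
- exact: solution_planar.
- by rewrite u0 vec0.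
- by rewrite u0 vec1.
- move=> e e0; have [M [_ hM]] := tu e e0.
  exists (M + 1) => t Mt; have [|z /= ->] := hM t; first by rewrite (lt_le_trans _ Mt)// ltrDl.
  by rewrite subr0 plane_norm_lt// => /andP[].
Qed.

(** A half-orbit is connected, being the image of a half-line. *)
Lemma backward_orbit_component {gs : set plane} {z : R -> plane} :
  continuous z -> (forall t, t <= 0 -> ~ gs (z t)) ->
  forall t, t <= 0 -> connected_component (~` gs) (z 0) (z t).
Proof.
move=> cz zgs t t0.
have c : connected (z @` `]-oo, 0]).
  apply: connected_continuous_connected.
    by apply/connected_intervalP; exact: interval_is_interval.
  by apply: continuous_subspaceT => s; exact: cz.
apply: (connected_component_max (B := z @` `]-oo, 0])) => //.
- by exists 0 => //; rewrite set_itvE/=.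
- by move=> _ [s + <-]; rewrite set_itvE/=; exact: zgs.
Qed.

Lemma bounded_entries {A : set plane} : bounded_set A ->
  exists B : R, forall a b, A (vec a b) -> `|a| <= B /\ `|b| <= B.
Proof.
move=> [M [_ hM]]; exists (M + 2) => a b /(hM (M + 1) _) h.
have {}h : `|vec a b| < M + 2 by rewrite (le_lt_trans (h _)) ?ltrD2l ?ltrDl// ltr1n.
have M2 : 0 < M + 2 := le_lt_trans (normr_ge0 _) h.
by move: h; rewrite plane_norm_lt// vec0 vec1 => /andP[/ltW ? /ltW].
Qed.

End Main.

Theorem theorem1 (R : realType) (F : 'cV[R]_2 -> 'cV[R]_2) (gs : set 'cV[R]_2)
    (rho : R) (Phi : R -> 'cV[R]_2 * 'cV[R]_2 -> 'cV[R]_2 * 'cV[R]_2) :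
  standing_setting F gs ->
  0 < rho ->
  is_flow (star_field F rho) Phi ->
  inside gs `<=` D_set F rho ->
  exists U : set ('cV[R]_2 * 'cV[R]_2),
    (forall w, U w -> Phi t w @[t --> +oo] --> (0 : 'cV[R]_2 * 'cV[R]_2)) /\
    (fst @` U) `&` gs !=set0.
Proof.
move=> [sF [[F0 as0] _ in0] _ _ _] rho0 flow insideD.
have Cf := smooth_C1 F sF 0; have Cg := smooth_C1 F sF 1.
have LL := smooth_lipschitz F sF.
have lip := star_locally_lipschitz (rho := rho) Cf Cg (LL 0 0) (LL 0 1) (LL 1 0) (LL 1 1).
have [stab [r r0 attr]] := asymptotically_stable_planar F as0.
have D0 : definite_coord F rho 0 0.
  by apply: D_set_definite; rewrite vec00; exact: insideD.
have [d d0 conv] := star_attracts Cf Cg (LL 0 0) (LL 0 1) (LL 1 0) (LL 1 1) r0 D0 attr stab.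
have odePhi w := solution_ode F rho (flow w).2.
pose loop a : 'cV[R]_2 * 'cV[R]_2 := (0, vec (d * cos a) (d * sin a)).
have [[a [t [t0 gst]]]|never] :=
    pselect (exists a t, t <= 0 /\ gs (Phi t (loop a)).1); last first.
  exfalso.
  pose C x y := connected_component (~` gs) 0 (vec x y).
  have [B hB] := bounded_entries in0.2.
  apply: (loop_not_trapped Cf Cg (LL 0 0) (LL 0 1) (LL 1 0) (LL 1 1) rho0 _ _ C B hB _
    d (fun a i t => state_coord (Phi t (loop a)) i) d0).
  - by rewrite /component vec00 F0 mxE.
  - by rewrite /component vec00 F0 mxE.
  - move=> x y Cxy; apply/D_set_definite/insideD; split.
      exact: connected_component_sub Cxy.
    by rewrite -(same_connected_component Cxy); exact: in0.2.
  - by move=> a; exact: odePhi.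
  - move=> a; rewrite (flow (loop a)).1 /state_coord/= vec0 vec1 !mxE.
    by split.
  - move=> a t t0; rewrite /C vec_eta.
    have := @backward_orbit_component R gs (fun t => (Phi t (loop a)).1).
    rewrite (flow (loop a)).1 => /(_ _ _ t t0); apply.
      move=> s; have ds := (flow (loop a)).2 s.
      have dc : {for s, continuous (Phi ^~ (loop a))}.
        by apply/differentiable_continuous/derivable1_diffP.
      exact: (continuous_comp dc cvg_fst).
    by move=> s s0 gs_s; apply: never; exists a, s.
exists [set Phi t (loop a)]; split; last first.
  exists (Phi t (loop a)).1; split => //.
  by exists (Phi t (loop a)).
move=> _ ->; apply/cvgrPdist_lt => e e0.
have small i : `|state_coord (Phi 0 (loop a)) i| <= d.
  rewrite (flow (loop a)).1 /state_coord; case: i => [[] []]; rewrite /= ?vec0 ?vec1 ?mxE ?normr0 ?(ltW d0)//.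
    by rewrite normrM (gtr0_norm d0) ler_piMr ?(ltW d0)// ler_norml sin_geN1 sin_le1.
  by rewrite normrM (gtr0_norm d0) ler_piMr ?(ltW d0)// ler_norml cos_geN1 cos_le1.
have [T hT] := conv _ (odePhi (loop a)) small e e0.
near=> s.
rewrite sub0r normrN; apply: coord_small => // i.
have s0 : 0 <= s by near: s; apply: nbhs_pinfty_ge; exact: num_real.
have -> : state_coord (Phi s (Phi t (loop a))) i = state_coord (Phi (s + t) (loop a)) i.
  apply: (ode_unique lip (odePhi _) (ode_shift t (odePhi (loop a)))) => // j.
  by rewrite (flow _).1 add0r.
apply: hT; rewrite -lerBlDr; near: s; apply: nbhs_pinfty_ge; exact: num_real.
Unshelve. all: by end_near. Qed.
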